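(* (a) Fix a constant $T\ge 0$. There is a polynomial-time algorithm that, given two MSyDSs on a common node set in which every local function is a threshold function with threshold value at most $T$ and every master function is \texttt{OR}, decides whether they are equivalent. (b) Fix a constant $N\ge 0$. There is a polynomial-time algorithm that, given two MSyDSs on a common node set in which every local function is a threshold function with negative threshold value at most $N$ and every master function is \texttt{AND}, decides whether they are equivalent.
   Context: A multilayer synchronous dynamical system (MSyDS) $\mathcal{S}$ over $\mathbb{B}=\{0,1\}$ with $k\ge 1$ layers consists of: a finite node set $V$; undirected simple graphs $G_i=(V,E_i)$, $1\le i\le k$ (all layers share the node set $V$); for each layer $i$ and node $v$ a local function $f_{i,v}$ with output in $\mathbb{B}$ whose inputs are the states of the nodes in the closed neighborhood of $v$ in $G_i$ ($v$ and its neighbors in $G_i$); and for each node $v$ a master function $\psi_v:\mathbb{B}^k\to\mathbb{B}$. A configuration is a map $\mathcal{C}:V\to\mathbb{B}$; its successor is $\mathcal{C}'$ with $\mathcal{C}'(v)=\psi_v(f_{1,v}(\mathcal{C}),\dots,f_{k,v}(\mathcal{C}))$ for all $v$ (synchronous update), where $f_{i,v}(\mathcal{C})$ is $f_{i,v}$ evaluated on the states in $\mathcal{C}$ of the closed neighborhood of $v$ in $G_i$. For an integer $t\ge 0$, the $t$-threshold function equals 1 iff at least $t$ of its inputs equal 1; threshold local functions are specified by their integer thresholds. If the local function of $v$ in layer $i$ is the $t$-threshold function and $v$ has degree $\delta$ in $G_i$, its negative threshold is $\delta - t + 2$. \texttt{OR} is 1 iff at least one input is 1; \texttt{AND} is 1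 iff all inputs are 1. Two MSyDSs on the same node set are equivalent if their phase spaces are identical, i.e., every configuration has the same successor under both. Polynomial time is measured in the size of the input (graphs of all layers and thresholds). *)

(* Defs.v *)
From mathcomp Require Import all_boot.
Unset Printing Implicit Defensive.

Record tmsyds (n : nat) := TMSyDS {
  nlayers : nat;
  adj : 'I_nlayers -> 'I_n -> 'I_n -> bool;
  thr : 'I_nlayers -> 'I_n -> nat
}.
Arguments nlayers {n} t : rename.
Arguments adj {n} t _ _ _ : rename.
Arguments thr {n} t _ _ : rename.
Arguments TMSyDS {n} nlayers adj thr.

Definition wf_tmsyds {n} (S : tmsyds n) : Prop :=
  0 < nlayers S /\
  forall i : 'I_(nlayers S),
    (forall u v, adj S i u v = adj S i v u) /\ (forall v, adj S i v v = false).

Definition cnbhd {n} (S : tmsyds n) (i : 'I_(nlayers S)) (v : 'I_n) : seq 'I_n :=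
  [seq u <- enum 'I_n | (u == v) || adj S i v u].

Definition deg {n} (S : tmsyds n) (i : 'I_(nlayers S)) (v : 'I_n) : nat :=
  #|[pred u | adj S i v u]|.

Definition threshold_fun (t : nat) (s : seq bool) : bool := t <= count id s.

Definition OR_fun (s : seq bool) : bool := has id s.
Definition AND_fun (s : seq bool) : bool := all id s.

Definition config (n : nat) := {ffun 'I_n -> bool}.

Definition local_val {n} (S : tmsyds n) (i : 'I_(nlayers S)) (v : 'I_n)
  (C : config n) : bool :=
  threshold_fun (thr S i v) [seq C u | u <- cnbhd S i v].

Definition succ {n} (psi : seq bool -> bool) (S : tmsyds n) (C : config n) : config n :=
  [ffun v => psi [seq local_val S i v C | i <- enum 'I_(nlayers S)]].

Definition equivalent {n} (psi : seq bool -> bool) (S1 S2 : tmsyds n) : Prop :=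
  forall C : config n, succ psi S1 C = succ psi S2 C.

Definition thr_at_most {n} (T : nat) (S : tmsyds n) : Prop :=
  forall i v, thr S i v <= T.

(* negative threshold deg - t + 2 <= N, written without subtraction *)
Definition negthr_at_most {n} (N : nat) (S : tmsyds n) : Prop :=
  forall i v, deg S i v + 2 <= N + thr S i v.

Fixpoint bits_aux (fuel m : nat) : seq bool :=
  match fuel with
  | 0 => [::]
  | fuel'.+1 => if m is 0 then [::] else odd m :: bits_aux fuel' m./2
  end.
Definition bits (m : nat) : seq bool := bits_aux m m.

(* self-delimiting encoding of a natural number *)
Definition enc_nat (m : nat) : seq bool :=
  flatten [seq [:: true; b] | b <- bits m] ++ [:: false; false].

Definition nats_of_tmsyds {n} (S : tmsyds n) : seq nat :=
  nlayers S ::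
  flatten [seq [seq nat_of_bool (adj S i u v) | u <- enum 'I_n, v <- enum 'I_n] | i <- enum 'I_(nlayers S)]
  ++ [seq thr S i v | i <- enum 'I_(nlayers S), v <- enum 'I_n].

Definition enc_instance {n} (S1 S2 : tmsyds n) : seq bool :=
  flatten (map enc_nat (n :: nats_of_tmsyds S1 ++ nats_of_tmsyds S2)).

Definition sym := option bool.   (* None = blank *)

Inductive move := MoveL | MoveR | Stay.

Record TM := MkTM {
  tm_state : finType;
  tm_start : tm_state;
  tm_halt : tm_state -> bool;
  tm_accept : tm_state -> bool;
  tm_delta : tm_state -> sym -> tm_state * sym * move
}.

Record tm_config (M : TM) := TMConfig {
  cf_state : tm_state M;
  cf_left : seq sym;   (* cells left of the head, nearest first *)
  cf_head : sym;
  cf_right : seq sym   (* cells right of the head, nearest first *)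
}.

Definition tm_step (M : TM) (c : tm_config M) : tm_config M :=
  let: TMConfig q l h r := c in
  if tm_halt M q then c else
  let: (q', w, mv) := tm_delta M q h in
  match mv with
  | Stay => @TMConfig M q' l w r
  | MoveL => @TMConfig M q' (behead l) (head None l) (w :: r)
  | MoveR => @TMConfig M q' (w :: l) (head None r) (behead r)
  end.

Definition tm_init (M : TM) (x : seq bool) : tm_config M :=
  @TMConfig M (tm_start M) [::] (head None (map Some x)) (behead (map Some x)).

(* M, started on x, has halted after at most t steps (halting states are
   fixed points of tm_step), and it halted in an accepting state iff P *)
Definition tm_decides_within (M : TM) (x : seq bool) (t : nat) (P : Prop) : Prop :=
  let c := iter t (@tm_step M) (tm_init M x) in
  tm_halt M (cf_state M c) /\ (tm_accept M (cf_state M c) = true <-> P).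

(* Main.v *)
From Stdlib Require Import ZArith FunctionalExtensionality.
Require Import Defs.
From mathcomp Require Import all_boot zify.

(** Put pol = false for OR masters and pol = true for AND masters. Up to
    complementing configurations and outputs when pol = true, a layer of a node v
    fires as soon as a set B of ones (zeros, for AND) meets the closed
    neighbourhood of v in at least trigger <= T points, and the successor of v
    records whether some layer fires. This is monotone in B and already witnessed
    by subsets of size at most T, so two systems are equivalent iff they agree on
    the configurations supported by the values of a tuple a_0, ..., a_(T-1).

    These O((n+1)^T) tuples are enumerated by a program of counter loops with one
    two-way input head; all counters but the thresholds are small, and thresholds,
    which may be exponentially large for AND, are compared bit by bit with a
    unary count. A counter machine becomes a Turing machine by keeping its unary
    counters on interleaved tracks left of the input. *)

Set Implicit Arguments.
Unset Strict Implicit.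
Unset Printing Implicit Defensive.

(** * Compiling structured programs to Turing machines *)

(** The time bound counts steps of a one-tape machine on a bit string, so every level, from tape
    programs to counter programs, carries explicit costs. Unary counters are affordable only because
    the encoding writes a full adjacency matrix per layer: for a nonempty node set this bounds [n]
    and both layer counts by the input length. Nothing bounds a threshold in this way; what is
    bounded is the count it is compared with, which never exceeds [n].

    Under AND the quantity playing the role of the threshold is the number of zeros that force a
    layer to output 0. A closed neighbourhood has [deg + 1] points, and fewer than [t] of them are
    ones as soon as [deg + 2 - t] are zeros: this is the negative threshold, so its bound [N] serves
    as [T].

    [T] is the depth of the loop nest over tuples. It enters the program text and the exponent of
    the time bound, which is why it has to be a constant. Tuple entries range over [0..n], where [n]
    is not a node, so that one loop nest covers all sets of size at most [T], not only those of size
    exactly [T]. *)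

Inductive cmd :=
| Nop
| Wr of sym
| Mv of move
| Seq of cmd & cmd
| If of (sym -> bool) & cmd & cmd
| While of (sym -> bool) & cmd.

Definition tape := ((Z -> sym) * Z)%type.

Definition wr (f : Z -> sym) z w : Z -> sym := fun y => if Z.eqb y z then w else f y.

Definition mvz m z :=
  match m with MoveL => Z.pred z | MoveR => Z.succ z | Stay => z end.

Lemma wr_same f z : wr f z (f z) = f.
Proof.
apply: functional_extensionality => y; rewrite /wr.
by case: Z.eqb_spec => // ->.
Qed.

(** The costs are the exact step counts of the compiled code: the first branch of a test pays for
    the test and for the jump over the second branch, the second one only for the test, and a loop
    round pays for the test and the jump back. *)
Inductive exec : cmd -> tape -> tape -> nat -> Prop :=
| ENop t : exec Nop t t 0
| EWr f z w : exec (Wr w) (f, z) (wr f z w, z) 1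
| EMv f z m : exec (Mv m) (f, z) (f, mvz m z) 1
| ESeq c1 c2 t1 t2 t3 k1 k2 :
    exec c1 t1 t2 k1 -> exec c2 t2 t3 k2 -> exec (Seq c1 c2) t1 t3 (k1 + k2)
| EIfT (P : sym -> bool) c1 c2 f z t k :
    P (f z) -> exec c1 (f, z) t k -> exec (If P c1 c2) (f, z) t k.+2
| EIfF (P : sym -> bool) c1 c2 f z t k :
    ~~ P (f z) -> exec c2 (f, z) t k -> exec (If P c1 c2) (f, z) t k.+1
| EWhF (P : sym -> bool) c f z : ~~ P (f z) -> exec (While P c) (f, z) (f, z) 1
| EWhT (P : sym -> bool) c f z t1 t2 k1 k2 :
    P (f z) -> exec c (f, z) t1 k1 -> exec (While P c) t1 t2 k2 ->
    exec (While P c) (f, z) t2 (k1 + k2).+2.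

Definition instr := sym -> sym * move * nat.

Definition jump b : instr := fun h => (h, Stay, b).

Fixpoint clen c :=
  match c with
  | Nop => 0
  | Wr _ | Mv _ => 1
  | Seq c1 c2 => clen c1 + clen c2
  | If _ c1 c2 => (clen c1 + clen c2).+2
  | While _ c => (clen c).+2
  end.

Fixpoint compile c a : seq instr :=
  match c with
  | Nop => [::]
  | Wr w => [:: fun _ => (w, Stay, a.+1)]
  | Mv m => [:: fun h => (h, m, a.+1)]
  | Seq c1 c2 => compile c1 a ++ compile c2 (a + clen c1)
  | If P c1 c2 =>
      (fun h => (h, Stay, if P h then a.+1 else a.+2 + clen c1)) ::
      compile c1 a.+1 ++ jump (a.+2 + clen c1 + clen c2) ::
      compile c2 (a.+2 + clen c1)
  | While P c =>
      (fun h => (h, Stay, if P h then a.+1 else a.+2 + clen c)) ::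
      compile c a.+1 ++ [:: jump a]
  end.

Lemma size_compile c a : size (compile c a) = clen c.
Proof.
elim: c a => //= [c1 IH1 c2 IH2|P c1 IH1 c2 IH2|P c IH] a.
- by rewrite size_cat IH1 IH2.
- by rewrite size_cat /= IH1 IH2 addnS.
- by rewrite size_cat /= IH addn1.
Qed.

(** Machine states form an ordinal type and addresses are cast into it by [inord], which is faithful
    only for targets in range. *)
Definition targets_le b (I : instr) := [forall h : option bool, (I h).2 <= b].

Lemma targets_le_trans b b' s :
  b <= b' -> all (targets_le b) s -> all (targets_le b') s.
Proof.
move=> bb'; apply: sub_all => I /forallP H; apply/forallP => h.
exact: leq_trans (H h) bb'.
Qed.

Lemma compile_targets c a : all (targets_le (a + clen c)) (compile c a).
Proof.
elim: c a => //= [w|m|c1 IH1 c2 IH2|P c1 IH1 c2 IH2|P c IH] a.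
- by rewrite andbT; apply/forallP => h /=; rewrite addn1.
- by rewrite andbT; apply/forallP => h /=; rewrite addn1.
- rewrite all_cat; apply/andP; split.
    by apply: targets_le_trans (IH1 a); lia.
  by apply: targets_le_trans (IH2 _); lia.
- apply/andP; split; first by apply/forallP => h /=; case: (P h); lia.
  rewrite all_cat /=; apply/and3P; split.
  + by apply: targets_le_trans (IH1 _); lia.
  + by apply/forallP => h /=; lia.
  + by apply: targets_le_trans (IH2 _); lia.
- apply/andP; split; first by apply/forallP => h /=; case: (P h); lia.
  rewrite all_cat /= andbT; apply/andP; split.
  + by apply: targets_le_trans (IH _); lia.
  + by apply/forallP => h /=; lia.
Qed.

(* Addresses beyond the code are fixed points, exactly as for halting states. *)
Definition cstep (G : seq instr) (a : nat * tape) : nat * tape :=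
  let: (pc, (f, z)) := a in
  if pc < size G then
    let: (w, m, pc') := nth (jump 0) G pc (f z) in (pc', (wr f z w, mvz m z))
  else a.

Arguments cstep : simpl never.

Lemma cstep_mid pre I post f z :
  cstep (pre ++ I :: post) (size pre, (f, z)) =
  ((I (f z)).2, (wr f z (I (f z)).1.1, mvz (I (f z)).1.2 z)).
Proof.
rewrite /cstep size_cat /= addnS ltnS leq_addr nth_cat ltnn subnn /=.
by case: (I (f z)) => [[]].
Qed.

Lemma cstep_at G pre I post pc f z :
  G = pre ++ I :: post -> pc = size pre ->
  cstep G (pc, (f, z)) =
  ((I (f z)).2, (wr f z (I (f z)).1.1, mvz (I (f z)).1.2 z)).
Proof. by move=> -> ->; apply: cstep_mid. Qed.

(** Jump targets are absolute, so the code is placed in an arbitrary context at its own address.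
    Induction is on the execution, not on the program: after one round of a loop the second
    hypothesis speaks of the same loop again. *)
Lemma compile_exec c t t' k : exec c t t' k ->
  forall G pre post a, G = pre ++ compile c a ++ post -> a = size pre ->
  iter k (cstep G) (a, t) = (a + clen c, t').
Proof.
elim=> {c t t' k}.
- by move=> t G pre post a _ _ /=; rewrite addn0.
- move=> f z w G pre post a -> ea /=.
  by rewrite (cstep_at f z erefl ea) /= addn1.
- move=> f z m G pre post a -> ea /=.
  by rewrite (cstep_at f z erefl ea) /= addn1 wr_same.
- move=> c1 c2 t1 t2 t3 k1 k2 _ IH1 _ IH2 G pre post a /= eG ea.
  rewrite addnC iterD (IH1 G pre (compile c2 (a + clen c1) ++ post)) //; last first.
    by rewrite eG -catA.
  rewrite (IH2 G (pre ++ compile c1 a) post) ?addnA //.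
    by rewrite eG !catA.
  by rewrite size_cat size_compile ea.
- move=> P c1 c2 f z [f' z'] k Pf _ IH G pre post a /= eG ea.
  rewrite -iterS iterSr.
  rewrite (cstep_at f z eG ea) /= Pf wr_same /=.
  rewrite (IH G (rcons pre (fun h => (h, Stay, if P h then a.+1 else a.+2 + clen c1)))
    (jump (a.+2 + clen c1 + clen c2) :: compile c2 (a.+2 + clen c1) ++ post)).
  + rewrite (@cstep_at _ (pre ++ (fun h => (h, Stay, if P h then a.+1 else a.+2 + clen c1)) :: compile c1 a.+1) (jump (a.+2 + clen c1 + clen c2))
      (compile c2 (a.+2 + clen c1) ++ post)) /=.
    * by rewrite wr_same; congr pair; lia.
    * by rewrite eG -?catA /= -?catA.
    * by rewrite size_cat /= size_compile ea; lia.
  + by rewrite cat_rcons eG /= -?catA.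
  + by rewrite size_rcons ea.
- move=> P c1 c2 f z t k Pf _ IH G pre post a /= eG ea.
  rewrite -iterS iterSr (cstep_at f z eG ea) /= (negbTE Pf) wr_same.
  rewrite (IH G (pre ++ (fun h => (h, Stay, if P h then a.+1 else a.+2 + clen c1)) ::
     compile c1 a.+1 ++ [:: jump (a.+2 + clen c1 + clen c2)]) post).
  + by congr pair; lia.
  + by rewrite eG -?catA /= -?catA.
  + by rewrite size_cat /= size_cat /= size_compile ea; lia.
- move=> P c f z Pf G pre post a /= eG ea.
  by rewrite (cstep_at f z eG ea) /= (negbTE Pf) wr_same; congr pair; lia.
- move=> P c f z [f1 z1] t2 k1 k2 Pf _ IH1 _ IH2 G pre post a eG ea; rewrite /= in eG.
  (* In order of time: the test, [k1] steps of the body, the jump back, then [k2] steps from the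
     start of the same loop. *)
  have -> : (k1 + k2).+2 = k2 + k1.+2 by lia.
  rewrite iterD iterS iterSr.
  rewrite (cstep_at f z eG ea) /= Pf wr_same /=.
  rewrite (IH1 G (rcons pre (fun h => (h, Stay, if P h then a.+1 else a.+2 + clen c)))
    (jump a :: post)).
  + rewrite (@cstep_at _ (pre ++ (fun h => (h, Stay, if P h then a.+1 else a.+2 + clen c)) :: compile c a.+1) (jump a) post) /=.
    * by rewrite wr_same (IH2 G pre post).
    * by rewrite eG -?catA /= -?catA.
    * by rewrite size_cat /= size_compile ea; lia.
  + by rewrite cat_rcons eG /= -?catA.
  + by rewrite size_rcons ea.
Qed.

(** * The Turing machine of a program *)

Definition verdict_instr b : instr :=
  fun h => (h, Stay, if h == Some true then b else b.+1).

Definition cmd_code c : seq instr := rcons (compile c 0) (verdict_instr (clen c).+1).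

(** States up to [clen c] are code addresses, the last one holding the verdict; the two further
    states accept and reject. *)
Definition cmd_TM (c : cmd) : TM :=
  @MkTM 'I_(clen c).+3 ord0 (fun q => (clen c).+1 <= q) (fun q => q == (clen c).+1 :> nat)
    (fun q h => let: (w, m, pc) := nth (jump 0) (cmd_code c) q h in (inord pc, w, m)).

(** Reading the two finite lists with default blank extends them to half-lines, so they can be
    compared with a tape indexed by integers. *)
Definition represents c (a : nat * tape) (d : tm_config (cmd_TM c)) :=
  let: (pc, (f, z)) := a in
  [/\ pc = cf_state _ d :> nat, cf_head _ d = f z,
      forall i, nth None (cf_left _ d) i = f (z - 1 - Z.of_nat i)%Z
    & forall i, nth None (cf_right _ d) i = f (z + 1 + Z.of_nat i)%Z].

Lemma size_cmd_code c : size (cmd_code c) = (clen c).+1.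
Proof. by rewrite size_rcons size_compile. Qed.

Lemma cmd_code_target c q h : q < (clen c).+1 ->
  (nth (jump 0) (cmd_code c) q h).2 < (clen c).+3.
Proof.
move=> qlt.
have : all (targets_le (clen c).+2) (cmd_code c).
  rewrite all_rcons; apply/andP; split.
    by apply/forallP => x /=; case: ifP.
  by apply: targets_le_trans (compile_targets c 0); rewrite add0n; lia.
move/(all_nthP (jump 0))=> /(_ q); rewrite size_cmd_code => /(_ qlt) /forallP /(_ h).
by [].
Qed.

Lemma represents_step c a d : represents a d ->
  represents (cstep (cmd_code c) a) (tm_step (cmd_TM c) d).
Proof.
case: a => pc [f z]; case: d => q l h r [/= epc eh el er].
rewrite /cstep size_cmd_code epc /=.
case: (ltnP q (clen c).+1) => qlt /=; last by split.
rewrite -eh; have := cmd_code_target h qlt.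
case: (nth _ _ _ h) => [[w m] pc'] /= pclt.
have wrh y : wr f z w y = if Z.eqb y z then w else f y by [].
case: m => /=; split=> /=; rewrite ?inordK //.
- rewrite -nth0 el wrh; case: Z.eqb_spec => [|_]; first by lia.
  by congr f; lia.
- move=> i; rewrite nth_behead el wrh; case: Z.eqb_spec => [|_]; first by lia.
  by congr f; lia.
- case=> [|i] /=; rewrite wrh; case: Z.eqb_spec => //=; try lia.
  by move=> _; rewrite er; congr f; lia.
- rewrite -nth0 er wrh; case: Z.eqb_spec => [|_]; first by lia.
  by congr f; lia.
- case=> [|i] /=; rewrite wrh; case: Z.eqb_spec => //=; try lia.
  by move=> _; rewrite el; congr f; lia.
- move=> i; rewrite nth_behead er wrh; case: Z.eqb_spec => [|_]; first by lia.
  by congr f; lia.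
- by rewrite wrh Z.eqb_refl.
- by move=> i; rewrite el wrh; case: Z.eqb_spec => [|_] //; lia.
- by move=> i; rewrite er wrh; case: Z.eqb_spec => [|_] //; lia.
Qed.

Lemma represents_iter c a d t : represents a d ->
  represents (iter t (cstep (cmd_code c)) a) (iter t (tm_step (cmd_TM c)) d).
Proof. by move=> r; elim: t => //= t; apply: represents_step. Qed.

Definition input_tape (x : seq bool) (z : Z) : sym :=
  if (z <? 0)%Z then None else nth None (map Some x) (Z.to_nat z).

Lemma represents_init c x :
  represents (0, (input_tape x, 0%Z)) (tm_init (cmd_TM c) x).
Proof.
split=> [||i|i]; rewrite /input_tape ?nth_nil ?nth_behead //.
- by case: Z.ltb_spec => //; lia.
- case: Z.ltb_spec => [|_]; first by lia.
  by congr (nth _ _ _); lia.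
Qed.

Lemma cmd_TM_decides c x f z k t (P : Prop) :
  exec c (input_tape x, 0%Z) (f, z) k -> k < t ->
  (f z == Some true <-> P) -> tm_decides_within (cmd_TM c) x t P.
Proof.
move=> ex kt fP.
have := represents_iter t (represents_init c x).
have -> : iter t (cstep (cmd_code c)) (0, (input_tape x, 0%Z)) =
  ((if f z == Some true then (clen c).+1 else (clen c).+2), (f, z)).
  rewrite -(subnK kt) iterD iterS.
  rewrite (@compile_exec _ _ _ _ ex (cmd_code c) [::] [:: verdict_instr (clen c).+1]) //;
    last by rewrite /cmd_code -cats1.
  rewrite (@cstep_at _ (compile c 0) (verdict_instr (clen c).+1) [::]);
    rewrite ?size_compile ?add0n // ?/cmd_code ?cats1 //.
  (* After the verdict the address lies beyond the code, so the remaining steps are idle. *)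
  rewrite /= wr_same; elim: (t - k.+1) => //= m ->.
  by rewrite /cstep size_cmd_code ltnNge; case: (f z == _); rewrite /= ltnS ?leqnn ?leqnSn.
case=> epc _ _ _; rewrite /tm_decides_within /= -epc; split.
  by case: ifP.
rewrite -fP; case: ifP => _; first by rewrite eqxx.
by split=> // /eqP; lia.
Qed.

(** * Counter programs on a tape *)

Definition reach c t t' b := exists2 k, exec c t t' k & k <= b.

Lemma reach_le c t t' b b' : b <= b' -> reach c t t' b -> reach c t t' b'.
Proof. by move=> bb' [k ex kb]; exists k => //; apply: leq_trans bb'. Qed.

Lemma reach_seq c1 c2 t1 t2 t3 b1 b2 :
  reach c1 t1 t2 b1 -> reach c2 t2 t3 b2 -> reach (Seq c1 c2) t1 t3 (b1 + b2).
Proof.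
move=> [k1 ex1 le1] [k2 ex2 le2]; exists (k1 + k2); last exact: leq_add.
exact: ESeq ex1 ex2.
Qed.

Lemma reach_if (P : sym -> bool) c1 c2 f z t b :
  reach (if P (f z) then c1 else c2) (f, z) t b ->
  reach (If P c1 c2) (f, z) t b.+2.
Proof.
case: ifP => [Pf|/negbT Pf] [k ex kb].
  by exists k.+2 => //; apply: EIfT.
by exists k.+1; [apply: EIfF|apply: leqW].
Qed.

Lemma reach_wr f z w : reach (Wr w) (f, z) (wr f z w, z) 1.
Proof. by exists 1 => //; apply: EWr. Qed.

Lemma reach_mv f z m : reach (Mv m) (f, z) (f, mvz m z) 1.
Proof. by exists 1 => //; apply: EMv. Qed.

(** The loop is specified by the sequence [S] of its tapes at the test rather than by an
    invariant. *)
Lemma reach_while (P : sym -> bool) c (S : nat -> tape) n b :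
  (forall j, j < n -> P ((S j).1 (S j).2) /\ reach c (S j) (S j.+1) b) ->
  ~~ P ((S n).1 (S n).2) -> reach (While P c) (S 0) (S n) (n * b.+2).+1.
Proof.
elim: n S => [|n IH] S step stop.
  exists 1 => //; move: stop; case: (S 0) => f z; exact: EWhF.
have [P0 [k1 ex1 le1]] := step 0 isT.
have [|k2 ex2 le2] := IH (fun j => S j.+1) _ stop; first by move=> j; apply: (step j.+1).
exists (k1 + k2).+2; last by lia.
by move: P0 ex1; case: (S 0) => f z /= P0 ex1; apply: EWhT ex2.
Qed.

Lemma reach_scan (P : sym -> bool) c f (z : nat -> Z) n b :
  (forall j, j < n -> P (f (z j)) /\ reach c (f, z j) (f, z j.+1) b) ->
  ~~ P (f (z n)) -> reach (While P c) (f, z 0) (f, z n) (n * b.+2).+1.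
Proof. exact: (@reach_while P c (fun j => (f, z j))). Qed.

Definition mvn m n : cmd := iter n (Seq (Mv m)) Nop.

Lemma reach_mvL f n z : reach (mvn MoveL n) (f, z) (f, (z - Z.of_nat n)%Z) n.
Proof.
elim: n z => [|n IH] z.
  have -> : (z - Z.of_nat 0)%Z = z by lia.
  by exists 0 => //; apply: ENop.
have -> : (z - Z.of_nat n.+1)%Z = (Z.pred z - Z.of_nat n)%Z by lia.
exact: reach_seq (reach_mv _ _ _) (IH _).
Qed.

Lemma reach_mvR f n z : reach (mvn MoveR n) (f, z) (f, (z + Z.of_nat n)%Z) n.
Proof.
elim: n z => [|n IH] z.
  have -> : (z + Z.of_nat 0)%Z = z by lia.
  by exists 0 => //; apply: ENop.
have -> : (z + Z.of_nat n.+1)%Z = (Z.succ z + Z.of_nat n)%Z by lia.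
exact: reach_seq (reach_mv _ _ _) (IH _).
Qed.

Definition upd (s : nat -> nat) r v := fun y => if y == r then v else s y.

Lemma updE s r v : upd s r v r = v. Proof. by rewrite /upd eqxx. Qed.

Definition nonblank (h : sym) := isSome h.
Definition blank (h : sym) := ~~ isSome h.
Definition is1 (h : sym) := h == Some true.

Section CounterMachine.

Variables (x : seq bool) (R : nat).

Definition st := ((nat -> nat) * nat)%type.

Local Notation W := (R.+1).

(* Cell -2 (home) stores the input bit under the input head, whose own cell is
   blanked; cell -1 stays blank, so that both can be located by scanning. Left
   of home, W tracks are interleaved: track 0 is blank except at home, and
   track r.+1 holds counter r in unary. *)
Definition track (s : st) q r : sym :=
  if r is r'.+1 then (if q < s.1 r' then Some true else None)
  else if q == 0 then Some (nth false x s.2) else None.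

Definition enc (s : st) (z : Z) : sym :=
  if (0 <=? z)%Z then
    if Z.to_nat z == s.2 then None else nth None (map Some x) (Z.to_nat z)
  else if (z =? -1)%Z then None
  else let j := Z.to_nat (-2 - z) in track s (j %/ W) (j %% W).

Definition home : Z := (-2)%Z.

Definition loc q r : Z := (-2 - Z.of_nat (q * W + r))%Z.

Lemma loc00 : loc 0 0 = home. Proof. by []. Qed.

Lemma enc_loc s q r : r < W -> enc s (loc q r) = track s q r.
Proof.
move=> rW; rewrite /enc /loc.
case: Z.leb_spec => [|_]; first by lia.
case: Z.eqb_spec => [|_]; first by lia.
have -> : Z.to_nat (-2 - (-2 - Z.of_nat (q * W + r)))%Z = q * W + r by lia.
by rewrite divnMDl // modnMDl divn_small // modn_small // addn0.
Qed.

Lemma enc_home s : enc s home = Some (nth false x s.2).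
Proof. by rewrite -loc00 enc_loc. Qed.

Lemma enc_sep s : enc s (-1)%Z = None.
Proof. by []. Qed.

Lemma enc_input s i : enc s (Z.of_nat i) =
  if i == s.2 then None else nth None (map Some x) i.
Proof.
rewrite /enc; case: Z.leb_spec => [_|]; last by lia.
by rewrite Nat2Z.id.
Qed.

(** Track cells lie left of the separator, so such a write leaves the input part alone and only the
    tracks need checking. *)
Lemma enc_wr_track s s' p q r w : r < W ->
  (forall q' r', r' < W -> track (s', p) q' r' =
     if (q' == q) && (r' == r) then w else track (s, p) q' r') ->
  wr (enc (s, p)) (loc q r) w = enc (s', p).
Proof.
move=> rW H; apply: functional_extensionality => z; rewrite /wr.
case: Z.eqb_spec => [->|ne]; first by rewrite enc_loc // H // !eqxx.
rewrite /enc; case: Z.leb_spec => // zneg; case: Z.eqb_spec => // z1.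
set j := Z.to_nat _; rewrite H ?ltn_mod //.
case: andP => // -[/eqP eq /eqP er]; case: ne.
have := divn_eq j W; rewrite eq er /loc /j; lia.
Qed.

Definition goR r := mvn MoveL r.+1.
Definition backR r := mvn MoveR r.+1.

Lemma reach_goR f r : reach (goR r) (f, home) (f, loc 0 r.+1) r.+1.
Proof.
have -> : loc 0 r.+1 = (home - Z.of_nat r.+1)%Z by rewrite /loc /home; lia.
exact: reach_mvL.
Qed.

Lemma reach_backR f q r : reach (backR r) (f, loc q r.+1) (f, loc q 0) r.+1.
Proof.
have -> : loc q 0 = (loc q r.+1 + Z.of_nat r.+1)%Z by rewrite /loc; lia.
exact: reach_mvR.
Qed.

Lemma reach_left f q r : reach (mvn MoveL W) (f, loc q r) (f, loc q.+1 r) W.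
Proof.
have -> : loc q.+1 r = (loc q r - Z.of_nat W)%Z by rewrite /loc; lia.
exact: reach_mvL.
Qed.

Lemma reach_right f q r : reach (mvn MoveR W) (f, loc q.+1 r) (f, loc q r) W.
Proof.
have -> : loc q r = (loc q.+1 r + Z.of_nat W)%Z by rewrite /loc; lia.
exact: reach_mvR.
Qed.

(** Strides of [W] cells stay on one track. The first blank of a counter track ends its unary
    number; on track 0 the only nonblank cell is home, which always holds a bit. *)
Definition scan_end := While nonblank (mvn MoveL W).
Definition scan_home := While blank (mvn MoveR W).

Lemma reach_scan_end s r : r < R ->
  reach scan_end (enc s, loc 0 r.+1) (enc s, loc (s.1 r) r.+1) (s.1 r * W.+2).+1.
Proof.
move=> rR; apply: (@reach_scan _ _ _ (fun q => loc q r.+1)) => [q qs|].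
  by rewrite enc_loc //= qs; split=> //; apply: reach_left.
by rewrite enc_loc //= ltnn.
Qed.

Lemma reach_scan_home s q :
  reach scan_home (enc s, loc q 0) (enc s, home) (q * W.+2).+1.
Proof.
have := @reach_scan blank (mvn MoveR W) (enc s) (fun j => loc (q - j) 0) q W.
rewrite subn0 subnn loc00; apply.
  move=> j jq; rewrite enc_loc //= /blank; split.
    by have -> : (q - j == 0) = false by lia.
  have -> : q - j = (q - j.+1).+1 by lia.
  exact: reach_right.
by rewrite enc_home.
Qed.

(** * Counter steps and their cost on the tape *)

Definition good M (s : st) := (forall r, s.1 r <= M) /\ s.2 < size x.

Lemma good_le M M' s : M <= M' -> good M s -> good M' s.
Proof. by move=> le [H1 H2]; split=> // r; apply: leq_trans le. Qed.

(** A generous bound for one primitive: a counter operation scans at most [M] rows out and back at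
    [W.+2] steps per row, and a head move crosses the input at most twice. *)
Definition unit_cost M := (6 * W + 24) * (M + size x + 1).

Lemma unit_cost_le M M' : M <= M' -> unit_cost M <= unit_cost M'.
Proof. by move=> le; rewrite /unit_cost leq_mul2l !leq_add2r le orbT. Qed.

(* Counters start at 0 and grow by at most one per primitive, so the counter
   machine time bounds the counters, hence also the Turing machine time of a
   primitive. *)
Definition runs c s s' k :=
  forall M, good M s ->
    good (M + k) s' /\
    reach c (enc s, home) (enc s', home) (k * unit_cost (M + k)).

Lemma runs_le c s s' k k' : k <= k' -> runs c s s' k -> runs c s s' k'.
Proof.
move=> le H M gM; have [g r] := H M gM; split.
  by apply: good_le g; rewrite leq_add2l.
by apply: reach_le r; apply: leq_mul => //; apply: unit_cost_le; rewrite leq_add2l.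
Qed.

Lemma runs_prim c s s' :
  (forall M, good M s ->
     good M.+1 s' /\ reach c (enc s, home) (enc s', home) (unit_cost M)) ->
  runs c s s' 1.
Proof.
move=> H M gM; have [g r] := H M gM; rewrite addn1 mul1n; split=> //.
by apply: reach_le r; apply: unit_cost_le.
Qed.

Lemma runs_nop s : runs Nop s s 0.
Proof. by move=> M gM; rewrite addn0; split=> //; exists 0 => //; apply: ENop. Qed.

Lemma runs_seq c1 c2 s1 s2 s3 k1 k2 :
  runs c1 s1 s2 k1 -> runs c2 s2 s3 k2 -> runs (Seq c1 c2) s1 s3 (k1 + k2).
Proof.
move=> H1 H2 M gM; have [g1 r1] := H1 M gM; have [g2 r2] := H2 _ g1.
rewrite addnA; split=> //; apply: reach_le (reach_seq r1 r2).
by rewrite mulnDl leq_add2r leq_mul2l unit_cost_le ?leq_addr ?orbT.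
Qed.

Definition Inc r :=
  Seq (goR r) (Seq scan_end (Seq (Wr (Some true)) (Seq (backR r) scan_home))).

Lemma runs_inc r s p : r < R -> runs (Inc r) (s, p) (upd s r (s r).+1, p) 1.
Proof.
move=> rR; apply: runs_prim => M [/= sM pL]; split.
  split=> //= r'; rewrite /upd; case: ifP => _; first by rewrite ltnS.
  exact: leqW.
have mark := reach_wr (enc (s, p)) (loc (s r) r.+1) (Some true).
rewrite (@enc_wr_track _ (upd s r (s r).+1)) // in mark; last first.
  move=> q' [|r'] r'W; rewrite /track /=; first by rewrite andbF.
  rewrite /upd eqSS; case: (eqVneq r' r) => [->|_]; last by rewrite andbF.
  by rewrite andbT ltnS leq_eqVlt; case: eqP.
have := reach_seq (reach_goR _ r) (reach_seq (reach_scan_end (s, p) rR)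
  (reach_seq mark (reach_seq (reach_backR _ _ r) (reach_scan_home _ _)))).
apply: reach_le; rewrite /unit_cost /=; have := sM r; nia.
Qed.

Definition Dec r :=
  Seq (goR r) (Seq scan_end (Seq (mvn MoveR W)
    (Seq (Wr None) (Seq (backR r) scan_home)))).

Lemma runs_dec r s p : r < R -> 0 < s r ->
  runs (Dec r) (s, p) (upd s r (s r).-1, p) 1.
Proof.
move=> rR; case E: (s r) => [|v] //= _; apply: runs_prim => M [/= sM pL]; split.
  split=> //= r'; rewrite /upd; case: ifP => _; last exact: leqW.
  by have := sM r; lia.
have := reach_scan_end (s, p) rR; rewrite /= E => scan.
have erase := reach_wr (enc (s, p)) (loc v r.+1) None.
rewrite (@enc_wr_track _ (upd s r v)) // in erase; last first.
  move=> q' [|r'] r'W; rewrite /track /=; first by rewrite andbF.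
  rewrite /upd eqSS; case: (eqVneq r' r) => [->|_]; last by rewrite andbF.
  by rewrite andbT E ltnS [q' <= v]leq_eqVlt; case: eqP => [->|//]; rewrite ltnn.
have := reach_seq (reach_goR _ r) (reach_seq scan (reach_seq (reach_right _ _ _)
  (reach_seq erase (reach_seq (reach_backR _ _ r) (reach_scan_home _ _))))).
apply: reach_le; rewrite /unit_cost /=; have := sM r; rewrite E; nia.
Qed.

Definition IfNZ r c1 c2 :=
  Seq (goR r) (If nonblank (Seq (backR r) c1) (Seq (backR r) c2)).

Lemma runs_ifnz r c1 c2 s s' k : r < R ->
  runs (if 0 < s.1 r then c1 else c2) s s' k -> runs (IfNZ r c1 c2) s s' k.+1.
Proof.
move=> rR H M gM; have [g rc] := H M gM; split.
  by apply: good_le g; rewrite leq_add2l.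
have {}rc : reach (If nonblank (Seq (backR r) c1) (Seq (backR r) c2))
    (enc s, loc 0 r.+1) (enc s', home) (r.+1 + k * unit_cost (M + k)).+2.
  apply: reach_if; rewrite enc_loc //=; move: rc.
  case: (0 < s.1 r) => rc;
    by apply: reach_seq rc; rewrite -loc00; apply: reach_backR.
apply: reach_le (reach_seq (reach_goR _ _) rc).
have := @unit_cost_le (M + k) (M + k.+1); rewrite leq_add2l leqnSn => /(_ isT) le.
have : 2 * W + 2 <= unit_cost (M + k.+1) by rewrite /unit_cost; nia.
by rewrite mulSn; have := leq_mul (leqnn k) le; lia.
Qed.

(** The test sits on the track of [r] while the body starts and ends at home, hence the detour in
    every round. *)
Definition WhileNZ r c :=
  Seq (goR r) (Seq (While nonblank (Seq (backR r) (Seq c (goR r)))) (backR r)).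

Lemma runs_whilenz r c (S : nat -> st) n k : r < R ->
  (forall j, j < n -> 0 < (S j).1 r /\ runs c (S j) (S j.+1) k) ->
  (S n).1 r = 0 -> runs (WhileNZ r c) (S 0) (S n) (n * k.+1).+1.
Proof.
move=> rR step stop M gM.
(* Counters grow by at most [k] per round, so the final bound [N] also bounds the unit cost of every
   round. *)
have gS j : j <= n -> good (M + j * k) (S j).
  elim: j => [|j IH] jn; first by rewrite addn0.
  have [_ H] := step j jn; have [g _] := H _ (IH (ltnW jn)).
  by apply: good_le g; rewrite mulSn; lia.
set N := M + (n * k.+1).+1.
have loop : reach (While nonblank (Seq (backR r) (Seq c (goR r))))
    (enc (S 0), loc 0 r.+1) (enc (S n), loc 0 r.+1)
    (n * (r.+1 + (k * unit_cost N + r.+1)).+2).+1.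
  apply: (@reach_while _ _ (fun j => (enc (S j), loc 0 r.+1))) => [j jn|] /=.
    have [nz H] := step j jn; rewrite enc_loc //=; split; first by rewrite nz.
    have [_ rc] := H _ (gS j (ltnW jn)).
    apply: reach_seq; first exact: reach_backR.
    rewrite loc00; apply: reach_seq (reach_goR _ _).
    apply: reach_le rc; apply: leq_mul => //; apply: unit_cost_le.
    by rewrite /N; nia.
  by rewrite enc_loc //= stop.
split; first by apply: good_le (gS n (leqnn n)); nia.
have := reach_seq (reach_goR _ r) (reach_seq loop (reach_backR _ 0 r)).
rewrite loc00; apply: reach_le; rewrite -/N.
have : 2 * W + 2 <= unit_cost N by rewrite /unit_cost; nia.
by move: (unit_cost N) => u; nia.
Qed.

(** The bit under the input head is kept at home, so testing it needs no travel. *)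
Definition IfBit c1 c2 := If is1 c1 c2.

Lemma is1_home s : is1 (enc s home) = nth false x s.2.
Proof. by rewrite enc_home /is1; case: (nth _ _ _). Qed.

Lemma runs_ifbit c1 c2 s s' k :
  runs (if nth false x s.2 then c1 else c2) s s' k -> runs (IfBit c1 c2) s s' k.+1.
Proof.
move=> H M gM; have [g rc] := H M gM; split.
  by apply: good_le g; rewrite leq_add2l.
have le := @unit_cost_le (M + k) (M + k.+1).
apply: (@reach_le _ _ _ (k * unit_cost (M + k)).+2).
  have {}le : unit_cost (M + k) <= unit_cost (M + k.+1) by apply: le; lia.
  have : 2 <= unit_cost (M + k.+1) by rewrite /unit_cost; nia.
  by rewrite mulSn; have := leq_mul (leqnn k) le; lia.
by apply: reach_if; rewrite is1_home.
Qed.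

Definition WhileBit c := While is1 c.

Lemma runs_whilebit c (S : nat -> st) n k :
  (forall j, j < n -> nth false x (S j).2 /\ runs c (S j) (S j.+1) k) ->
  nth false x (S n).2 = false -> runs (WhileBit c) (S 0) (S n) (n * k.+1).+1.
Proof.
move=> step stop M gM.
have gS j : j <= n -> good (M + j * k) (S j).
  elim: j => [|j IH] jn; first by rewrite addn0.
  have [_ H] := step j jn; have [g _] := H _ (IH (ltnW jn)).
  by apply: good_le g; rewrite mulSn; lia.
set N := M + (n * k.+1).+1.
have loop : reach (WhileBit c) (enc (S 0), home) (enc (S n), home)
    (n * (k * unit_cost N).+2).+1.
  apply: (@reach_while _ _ (fun j => (enc (S j), home))) => [j jn|].
    have [nz H] := step j jn; rewrite is1_home; split=> //.
    have [_ rc] := H _ (gS j (ltnW jn)).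
    apply: reach_le rc; apply: leq_mul => //; apply: unit_cost_le.
    by rewrite /N; nia.
  by rewrite is1_home stop.
split; first by apply: good_le (gS n (leqnn n)); nia.
apply: reach_le loop; rewrite -/N.
have : 2 <= unit_cost N by rewrite /unit_cost; nia.
by move: (unit_cost N) => u; nia.
Qed.

(** * Moves of the two-way input head *)

Definition to_head := Seq (mvn MoveR 2) (While nonblank (Mv MoveR)).

Lemma reach_to_head s : s.2 < size x ->
  reach to_head (enc s, home) (enc s, Z.of_nat s.2) (2 + (s.2 * 3).+1).
Proof.
move=> pL; apply: reach_seq; first exact: reach_mvR.
apply: (@reach_scan _ _ _ Z.of_nat) => [j jp|].
  rewrite enc_input ltn_eqF // (nth_map false) ?(ltn_trans jp) //; split=> //.
  have -> : Z.of_nat j.+1 = mvz MoveR (Z.of_nat j) by rewrite /=; lia.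
  exact: reach_mv.
by rewrite enc_input eqxx.
Qed.

Lemma reach_to_sep f i :
  (forall j, j < i -> nonblank (f (Z.of_nat j))) -> f (-1)%Z = None ->
  reach (While nonblank (Mv MoveL)) (f, (Z.of_nat i - 1)%Z) (f, (-1)%Z) (i * 3).+1.
Proof.
move=> nb sep.
have := @reach_scan nonblank (Mv MoveL) f (fun j => Z.of_nat i - 1 - Z.of_nat j)%Z i 1.
have -> : (Z.of_nat i - 1 - Z.of_nat 0)%Z = (Z.of_nat i - 1)%Z by lia.
have -> : (Z.of_nat i - 1 - Z.of_nat i)%Z = (-1)%Z by lia.
apply; last by rewrite sep.
move=> j ji; split.
  have -> : (Z.of_nat i - 1 - Z.of_nat j)%Z = Z.of_nat (i - j.+1) by lia.
  by apply: nb; lia.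
have -> : (Z.of_nat i - 1 - Z.of_nat j.+1)%Z =
  mvz MoveL (Z.of_nat i - 1 - Z.of_nat j)%Z by rewrite /=; lia.
exact: reach_mv.
Qed.

Definition bit_case (c : bool -> cmd) := If is1 (c true) (c false).

Lemma reach_bit_case c f z b t k : f z = Some b ->
  reach (c b) (f, z) t k -> reach (bit_case c) (f, z) t k.+2.
Proof. by move=> fz H; apply: reach_if; rewrite fz; case: b fz H. Qed.

(** [bit_case] duplicates code so that the finite control remembers a bit: [b] travels from home
    back into the old hole, [b'] from the new hole to home. *)
Definition Adv :=
  bit_case (fun b => Seq to_head (Seq (Wr (Some b)) (Seq (Mv MoveR)
    (bit_case (fun b' => Seq (Wr None) (Seq (Mv MoveL)
      (Seq (While nonblank (Mv MoveL)) (Seq (Mv MoveL) (Wr (Some b')))))))))).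

Definition Rew :=
  bit_case (fun b => Seq to_head (Seq (Wr (Some b)) (Seq (Mv MoveL)
    (Seq (While nonblank (Mv MoveL)) (Seq (Mv MoveR)
    (bit_case (fun b' => Seq (Wr None) (Seq (mvn MoveL 2) (Wr (Some b')))))))))).

Lemma wr_at f z w : wr f z w z = w.
Proof. by rewrite /wr Z.eqb_refl. Qed.

Lemma wr_ne f z w y : y <> z -> wr f z w y = f y.
Proof. by rewrite /wr; case: Z.eqb_spec. Qed.

(* Moving the hole of the input head from p to p'. *)
Lemma enc_move_head s p p' : p < size x -> p' < size x ->
  wr (wr (wr (enc (s, p)) (Z.of_nat p) (Some (nth false x p)))
    (Z.of_nat p') None) home (Some (nth false x p')) = enc (s, p').
Proof.
move=> pL p'L; apply: functional_extensionality => z.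
case: (Z.eqb_spec z home) => [->|zh]; first by rewrite wr_at enc_home.
rewrite wr_ne //; case: (Z.eqb_spec z (Z.of_nat p')) => [->|zp'].
  by rewrite wr_at enc_input eqxx.
rewrite wr_ne //; case: (Z.eqb_spec z (Z.of_nat p)) => [zp|zp].
  rewrite zp wr_at enc_input /=; case: eqP => [E|_]; first by case: zp'; rewrite zp E.
  by rewrite (nth_map false).
rewrite wr_ne // /enc; case: Z.leb_spec => [z0|z0] /=.
  do 2 (case: eqP => [|_]; first by lia).
  by [].
case: Z.eqb_spec => // z1; rewrite /track /=; case E: (_ %% _) => [|//].
case: eqP => // E'; case: zh; have := divn_eq (Z.to_nat (-2 - z)) W.
by rewrite E E' /home; lia.
Qed.

Lemma enc_fill s p i : p < size x -> i < size x ->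
  wr (enc (s, p)) (Z.of_nat p) (Some (nth false x p)) (Z.of_nat i) =
  Some (nth false x i).
Proof.
move=> pL iL; case: (eqVneq i p) => [->|ne]; first by rewrite wr_at.
rewrite wr_ne; last by move/Nat2Z.inj/eqP; rewrite (negbTE ne).
by rewrite enc_input /= (negbTE ne) (nth_map false).
Qed.

Lemma runs_adv s p : p.+1 < size x -> runs Adv (s, p) (s, p.+1) 1.
Proof.
move=> pL; apply: runs_prim => M [/= sM pL']; split.
  by split=> //= r; apply: leqW.
set f1 := wr (enc (s, p)) (Z.of_nat p) (Some (nth false x p)).
set f2 := wr f1 (Z.of_nat p.+1) None.
suff H : reach Adv (enc (s, p), home) (enc (s, p.+1), home)
    (2 + (p * 3).+1 + (1 + (1 + (1 + (1 + ((p.+1 * 3).+1 + (1 + 1)))).+2))).+2.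
  by apply: reach_le H; rewrite /unit_cost; nia.
apply: reach_bit_case; first exact: enc_home.
apply: reach_seq; first exact: reach_to_head.
apply: reach_seq; first exact: reach_wr.
apply: reach_seq; first exact: reach_mv.
rewrite /= -/f1; have -> : Z.succ (Z.of_nat p) = Z.of_nat p.+1 by lia.
apply: reach_bit_case; first exact: enc_fill.
apply: reach_seq; first exact: reach_wr.
apply: reach_seq; first exact: reach_mv.
rewrite -/f2; have -> : mvz MoveL (Z.of_nat p.+1) = (Z.of_nat p.+1 - 1)%Z by rewrite /=; lia.
apply: reach_seq.
  apply: reach_to_sep => [j jp|].
    by rewrite /f2 wr_ne; [rewrite /f1 enc_fill //; lia | lia].
  by rewrite /f2 wr_ne; [rewrite /f1 wr_ne; [exact: enc_sep|lia]|lia].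
apply: reach_seq; first exact: reach_mv.
by rewrite -(enc_move_head s pL' pL); apply: reach_wr.
Qed.

Lemma runs_rew s p : runs Rew (s, p) (s, 0) 1.
Proof.
apply: runs_prim => M [/= sM pL]; have L0 : 0 < size x by apply: leq_ltn_trans pL.
split; first by split=> //= r; apply: leqW.
set f1 := wr (enc (s, p)) (Z.of_nat p) (Some (nth false x p)).
suff H : reach Rew (enc (s, p), home) (enc (s, 0), home)
    (2 + (p * 3).+1 + (1 + (1 + ((p * 3).+1 + (1 + (1 + (2 + 1)).+2))))).+2.
  by apply: reach_le H; rewrite /unit_cost; nia.
apply: reach_bit_case; first exact: enc_home.
apply: reach_seq; first exact: reach_to_head.
apply: reach_seq; first exact: reach_wr.
apply: reach_seq; first exact: reach_mv.
rewrite -/f1; have -> : mvz MoveL (Z.of_nat p) = (Z.of_nat p - 1)%Z by rewrite /=; lia.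
apply: reach_seq.
  apply: reach_to_sep => [j jp|]; first by rewrite /f1 enc_fill //; lia.
  by rewrite /f1 wr_ne; [exact: enc_sep|lia].
apply: reach_seq; first exact: reach_mv.
have -> : mvz MoveR (-1) = Z.of_nat 0 by [].
apply: reach_bit_case; first exact: enc_fill.
apply: reach_seq; first exact: reach_wr.
apply: reach_seq; first exact: reach_mvL.
by rewrite -(enc_move_head s pL L0); apply: reach_wr.
Qed.

(** With all counters 0 and the head at 0, the encoding differs from the input tape only in the hole
    at cell 0 and the bit at home. *)
Definition setup := bit_case (fun b => Seq (Wr None) (Seq (mvn MoveL 2) (Wr (Some b)))).

Lemma reach_setup : 0 < size x ->
  reach setup (input_tape x, 0%Z) (enc (fun=> 0, 0), home) 6.
Proof.
move=> L0; apply: (@reach_bit_case _ _ _ (nth false x 0)).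
  by rewrite /input_tape /= (nth_map false).
apply: (@reach_seq _ _ _ _ _ 1 3); first exact: reach_wr.
apply: (@reach_seq _ _ _ _ _ 2 1); first exact: reach_mvL.
suff -> : enc (fun=> 0, 0) = wr (wr (input_tape x) 0 None) home (Some (nth false x 0)).
  exact: reach_wr.
apply: functional_extensionality => z.
case: (Z.eqb_spec z home) => [->|zh]; first by rewrite wr_at enc_home.
rewrite wr_ne //; case: (Z.eqb_spec z 0) => [->|z0].
  by rewrite wr_at (enc_input _ 0).
rewrite wr_ne // /enc /input_tape; case: Z.leb_spec => [z1|z1] /=.
  case: Z.ltb_spec => [|_]; first by lia.
  by case: eqP => [|_] //; lia.
case: Z.ltb_spec => [_|]; last by lia.
case: Z.eqb_spec => // z2; rewrite /track /=; case E: (_ %% _) => [|//].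
case: eqP => // E'; case: zh; have := divn_eq (Z.to_nat (-2 - z)) W.
by rewrite E E' /home; lia.
Qed.

Definition verdict r :=
  Seq (goR r) (If nonblank (Wr (Some false)) (Wr (Some true))).

(** The initial state is good for [M = 0], so the number [k] of counter steps alone bounds the
    machine time. *)
Lemma program_decides c r s' p k d (P : Prop) : r < R -> 0 < size x ->
  runs c (fun=> 0, 0) (s', p) k ->
  6 + (k * unit_cost k + (r.+1 + 3)) < d ->
  (s' r = 0 <-> P) ->
  tm_decides_within (cmd_TM (Seq setup (Seq c (verdict r)))) x d P.
Proof.
move=> rR L0 H dk eP; have [|_ rc] := H 0; first by [].
have rv : reach (verdict r) (enc (s', p), home)
    (wr (enc (s', p)) (loc 0 r.+1) (Some (s' r == 0)), loc 0 r.+1) (r.+1 + 3).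
  apply: reach_seq; first exact: reach_goR.
  apply: reach_if; rewrite enc_loc //= lt0n.
  by case: eqP => _; apply: reach_wr.
have [k' ex le] := reach_seq (reach_setup L0) (reach_seq rc rv).
apply: cmd_TM_decides ex _ _; first by apply: leq_ltn_trans dk.
by rewrite wr_at -eP; split=> [/eqP [/eqP]|->].
Qed.

End CounterMachine.

(** * Derived counter programs *)

Lemma bits_aux_fuel m fuel : m <= fuel -> bits_aux fuel m = bits m.
Proof.
suff H k1 k2 n : n <= k1 -> n <= k2 -> bits_aux k1 n = bits_aux k2 n by move/H; apply.
elim: k1 k2 n => [|k1 IH] [|k2] [|n] //= n1 n2.
by congr cons; apply: IH; lia.
Qed.

Lemma bitsS m : 0 < m -> bits m = odd m :: bits m./2.
Proof.
case: m => // m _; rewrite {1}/bits [LHS]/=; congr cons.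
by rewrite bits_aux_fuel //; lia.
Qed.

Lemma halfX m i : m %/ 2 ^ i.+1 = m./2 %/ 2 ^ i.
Proof. by rewrite expnS divnMA divn2. Qed.

Lemma nth_bits m i : nth false (bits m) i = odd (m %/ 2 ^ i).
Proof.
elim: i m => [|i IH] [|m]; rewrite ?div0n //.
  by rewrite bitsS // divn1.
by rewrite bitsS // halfX -IH.
Qed.

Lemma size_bits_gt0 m : (0 < size (bits m)) = (0 < m).
Proof. by case: m. Qed.

Lemma bits_bound m : m < 2 ^ size (bits m).
Proof.
have [k] := ubnP m; elim: k m => // k IH [|m] // mk.
rewrite bitsS // -[size _]/((size _).+1) expnS.
by have := IH m.+1./2; lia.
Qed.

(** There are no leading zeros, so the weight of each written bit is at most the number. This keeps
    the powers of two built while reading affordable in unary. *)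
Lemma size_bits_ltn m i : i < size (bits m) -> 2 ^ i <= m.
Proof.
elim: i m => [|i IH] [|m] //; rewrite bitsS //= ltnS => /IH.
by rewrite expnS; lia.
Qed.

Lemma modn_exp2S m i : m %% 2 ^ i.+1 = odd (m %/ 2 ^ i) * 2 ^ i + m %% 2 ^ i.
Proof.
rewrite {1}(divn_eq m (2 ^ i)) -{1}(odd_double_half (m %/ 2 ^ i)) mulnDl addnAC.
rewrite addnC -muln2 -mulnA -expnS modnMDl modn_small // expnS.
have := ltn_pmod m (expn_gt0 2 i); case: odd; lia.
Qed.

Lemma size_enc_nat m : size (enc_nat m) = (size (bits m)).*2.+2.
Proof.
rewrite /enc_nat size_cat addn2; congr _.+2.
by elim: (bits m) => //= b s ->.
Qed.

Lemma nth_enc_nat_mark m i :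
  nth false (enc_nat m) i.*2 = (i < size (bits m)).
Proof.
rewrite /enc_nat; by elim: (bits m) i => [|b s IH] [|i] //=; rewrite ?nth_nil.
Qed.

Lemma nth_enc_nat_bit m i :
  nth false (enc_nat m) i.*2.+1 = nth false (bits m) i.
Proof.
rewrite /enc_nat; by elim: (bits m) i => [|b s IH] [|i] //=; rewrite ?nth_nil.
Qed.

Notation "c1 ;; c2" := (Seq c1 c2) (at level 60, right associativity).

Ltac upd_tac :=
  let y := fresh "y" in
  try apply: functional_extensionality => y; rewrite /upd /=;
  repeat (case: eqP => ?; subst); rewrite /= ?eqxx //; try lia.

Ltac upd_hyp H :=
  move: H; rewrite /upd /=; repeat (case: eqP => ?; subst); rewrite /= ?eqxx //;
  move=> H; upd_tac.

Lemma upd_same s r : upd s r (s r) = s.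
Proof. by upd_tac. Qed.

Section Macros.

Variables (x : seq bool) (R : nat).

Local Notation runs := (runs x R).
Local Notation Inc := (Inc R).
Local Notation Dec := (Dec R).

Lemma runs_inc_to r s p s' : r < R -> s' = upd s r (s r).+1 ->
  runs (Inc r) (s, p) (s', p) 1.
Proof. by move=> rR ->; apply: runs_inc. Qed.

Lemma runs_dec_to r s p s' : r < R -> 0 < s r -> s' = upd s r (s r).-1 ->
  runs (Dec r) (s, p) (s', p) 1.
Proof. by move=> rR s0 ->; apply: runs_dec. Qed.

Lemma runs_nop_to s p s' k : s' = s -> runs Nop (s, p) (s', p) k.
Proof. by move=> ->; apply: (runs_le (leq0n k)); apply: runs_nop. Qed.

Definition Move r t := WhileNZ r (Dec r ;; Inc t).

Lemma runs_move r t s p : r < R -> t < R -> r <> t ->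
  runs (Move r t) (s, p) (upd (upd s r 0) t (s t + s r), p) (s r * 3).+1.
Proof.
move=> rR tR rt.
have := @runs_whilenz x R r (Dec r ;; Inc t)
  (fun j => (upd (upd s r (s r - j)) t (s t + j), p)) (s r) 2 rR.
rewrite /= subnn subn0 addn0 upd_same.
have -> : upd s t (s t) = s by rewrite upd_same.
apply; last by upd_tac.
move=> j js; split; first by upd_tac.
apply: (@runs_seq _ _ _ _ _ _ _ 1 1); first by apply: runs_dec => //; upd_tac.
by apply: runs_inc_to => //; upd_tac.
Qed.

Lemma runs_move_to r t s p s' k : r < R -> t < R -> r <> t ->
  s' = upd (upd s r 0) t (s t + s r) -> s r * 3 < k ->
  runs (Move r t) (s, p) (s', p) k.
Proof. by move=> rR tR rt -> le; apply: (runs_le le); apply: runs_move. Qed.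

Definition Clear r := WhileNZ r (Dec r).

Lemma runs_clear r s p : r < R -> runs (Clear r) (s, p) (upd s r 0, p) (s r * 2).+1.
Proof.
move=> rR; have := @runs_whilenz x R r (Dec r) (fun j => (upd s r (s r - j), p)) (s r) 1 rR.
rewrite /= subnn subn0 upd_same; apply; last by upd_tac.
move=> j js; split; first by upd_tac.
by apply: runs_dec_to => //; upd_tac.
Qed.

Lemma runs_clear_to r s p s' k : r < R -> s' = upd s r 0 -> s r * 2 < k ->
  runs (Clear r) (s, p) (s', p) k.
Proof. by move=> rR -> le; apply: (runs_le le); apply: runs_clear. Qed.

(* The body sees the index in t and the number of remaining rounds in r. *)
Definition For r t p := WhileNZ r (Dec r ;; p ;; Inc t) ;; Move t r.

(** [F] describes the state as if the bound were not split; the body is run on the states obtained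
    from [F] by overwriting [r] and [t] with rounds left and rounds done. *)
Lemma runs_for r t p (F : nat -> st) n c : r < R -> t < R -> r <> t ->
  (F 0).1 r = n -> (F 0).1 t = 0 -> (F n).1 r = n -> (F n).1 t = 0 ->
  (forall j, j < n ->
     runs p (upd (upd (F j).1 r (n - j.+1)) t j, (F j).2)
            (upd (upd (F j.+1).1 r (n - j.+1)) t j, (F j.+1).2) c) ->
  runs (For r t p) (F 0) (F n) (n * (c + 6)).+2.
Proof.
move=> rR tR rt F0r F0t Fnr Fnt step.
pose S j : st := (upd (upd (F j).1 r (n - j)) t j, (F j).2).
have S0 : F 0 = S 0.
  by rewrite /S subn0 [LHS]surjective_pairing; congr pair; upd_tac.
have loop : runs (WhileNZ r (Dec r ;; p ;; Inc t)) (S 0) (S n) (n * (1 + (c + 1)).+1).+1.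
  apply: runs_whilenz => // [j jn|]; last by rewrite /S; upd_tac.
  split; first by rewrite /S; upd_tac.
  apply: runs_seq; first by apply: runs_dec => //; upd_tac.
  apply: runs_seq.
    by have := step j jn; congr (runs _ (_, _) _ _); rewrite /S; upd_tac.
  by apply: runs_inc_to => //; upd_tac.
have back := @runs_move t r (S n).1 (S n).2 tR rR (fun e => rt (esym e)).
rewrite S0; apply: (@runs_le _ _ _ _ _ ((n * (1 + (c + 1)).+1).+1 + (n * 3).+1)); first by lia.
apply: runs_seq loop _.
move: back; rewrite -surjective_pairing.
have -> : (S n).1 t = n by rewrite /S /= updE.
congr (runs _ _ _ _); rewrite [RHS]surjective_pairing; congr pair.
by rewrite /S /=; upd_tac.
Qed.

Local Notation z1 := 12.
Local Notation z4 := 21.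
Local Notation rf := 22.

(** A nondestructive test. Each unit of [a] shifts a unit of [b] into [z4] or, once [b] is empty,
    goes to [rf]; a leftover in [b] adds one more. Thus [rf] stays 0 iff the values agree, and
    moving [z4] back restores [b]. *)
Definition IfEq a b c1 c2 :=
  For a z1 (IfNZ b (Dec b ;; Inc z4) (Inc rf)) ;;
  IfNZ b (Inc rf) Nop ;;
  Move z4 b ;;
  IfNZ rf (Clear rf ;; c2) c1.

Definition scratch r := [|| r == z1, r == z4 | r == rf].

Lemma runs_ifeq a b c1 c2 s p s' k M : 30 <= R -> a < R -> b < R -> a <> b ->
  ~~ scratch a -> ~~ scratch b -> s z1 = 0 -> s z4 = 0 -> s rf = 0 ->
  s a <= M -> s b <= M ->
  runs (if s a == s b then c1 else c2) (s, p) s' k ->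
  runs (IfEq a b c1 c2) (s, p) s' (M * 14 + k + 20).
Proof.
move=> HR aR bR ab; rewrite /scratch !negb_or => /and3P [/eqP a1 /eqP a2 /eqP a3]
  /and3P [/eqP b1 /eqP b2 /eqP b3] s1 s2 s3 aM bM H.
pose F j : st := (upd (upd (upd s b (s b - j)) z4 (minn j (s b))) rf (j - s b), p).
have F0 : F 0 = (s, p) by congr pair; upd_tac.
have step1 : runs (For a z1 (IfNZ b (Dec b ;; Inc z4) (Inc rf))) (F 0) (F (s a))
    (s a * (3 + 6)).+2.
  apply: runs_for; try lia; rewrite ?F0 //; try by rewrite /F; upd_tac.
  move=> j ja; apply: runs_ifnz; first by lia.
  case: ifP; rewrite /F => Hb.
    apply: (@runs_seq _ _ _ _ _ _ _ 1 1); first by apply: runs_dec => //; lia.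
    by apply: runs_inc_to; [lia|upd_hyp Hb].
  by apply: (@runs_le _ _ _ _ _ 1) => //; apply: runs_inc_to; [lia|upd_hyp Hb].
rewrite F0 in step1.
apply: (@runs_le _ _ _ _ _ ((s a * (3 + 6)).+2 + (2 + ((M * 3).+1 + (((M.+1 * 2).+1 + k).+1))))).
  by lia.
apply: (runs_seq step1).
apply: (@runs_seq _ _ _ _ _ (upd (F (s a)).1 rf ((s a - s b) + (s a < s b)), p)).
  apply: runs_ifnz => //; case: ifP; rewrite /F => Hb.
    by apply: runs_inc_to; [lia|upd_hyp Hb].
  by apply: runs_nop_to; upd_hyp Hb.
apply: (@runs_seq _ _ _ _ _ (upd s rf ((s a - s b) + (s a < s b)), p)).
  by apply: runs_move_to; rewrite /F; upd_tac.
apply: runs_ifnz; first by lia.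
case: ifP; rewrite /= updE => Hn.
  apply: (@runs_seq _ _ _ _ _ (s, p)); last first.
    by move: H; case: eqP => // E; rewrite E in Hn; lia.
  by apply: runs_clear_to; upd_tac.
apply: (@runs_le _ _ _ _ _ k); first by lia.
move: H; case: eqP => [_|]; last by lia.
by congr (runs _ (_, _) _ _); upd_tac.
Qed.

End Macros.

(** * Reading encoded numbers *)

(** Bits arrive least significant first, so the newest bit outweighs all earlier ones: it decides
    unless both numbers share it, and then the earlier verdict stands. *)
Lemma leq_modn_exp2S v C i :
  (v %% 2 ^ i.+1 <= C %% 2 ^ i.+1) =
  (if odd (v %/ 2 ^ i) == odd (C %/ 2 ^ i) then v %% 2 ^ i <= C %% 2 ^ i
   else odd (C %/ 2 ^ i)).
Proof.
rewrite !modn_exp2S.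
have := ltn_pmod v (expn_gt0 2 i); have := ltn_pmod C (expn_gt0 2 i).
case: odd; case: odd => /=; lia.
Qed.

(** Any bit of [C] beyond the length of [v] outweighs all of [v]. *)
Lemma leq_div_mod v C n : v < 2 ^ n ->
  (v <= C) = (0 < C %/ 2 ^ n) || (v %% 2 ^ n <= C %% 2 ^ n).
Proof.
move=> vn; rewrite (modn_small vn) {1}(divn_eq C (2 ^ n)).
case: posnP => [->|C0] //=; have : 1 * 2 ^ n <= C %/ 2 ^ n * 2 ^ n by rewrite leq_mul2r C0 orbT.
lia.
Qed.

Definition encs (nums : seq nat) := flatten (map enc_nat nums).

Definition pos nums m := size (encs (take m nums)).

Lemma pos0 nums : pos nums 0 = 0.
Proof. by rewrite /pos take0. Qed.

Lemma posS nums m : m < size nums ->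
  pos nums m.+1 = pos nums m + (size (bits (nth 0 nums m))).*2.+2.
Proof.
move=> mN; rewrite /pos (take_nth 0 mN) /encs map_rcons flatten_rcons size_cat.
by rewrite size_enc_nat.
Qed.

Lemma encs_split nums m : m < size nums ->
  encs nums = encs (take m nums) ++ enc_nat (nth 0 nums m) ++ encs (drop m.+1 nums).
Proof.
move=> mN; rewrite -{1}(cat_take_drop m nums) (drop_nth 0 mN) /encs map_cat.
by rewrite flatten_cat.
Qed.

Lemma pos_lt nums m j : m < size nums ->
  j < (size (bits (nth 0 nums m))).*2.+2 -> pos nums m + j < size (encs nums).
Proof.
move=> mN jm; rewrite (encs_split mN) size_cat size_cat size_enc_nat -/(pos nums m).
by lia.
Qed.

Lemma nth_encs nums m j : m < size nums ->
  j < (size (bits (nth 0 nums m))).*2.+2 ->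
  nth false (encs nums) (pos nums m + j) = nth false (enc_nat (nth 0 nums m)) j.
Proof.
move=> mN jm; rewrite (encs_split mN) nth_cat -/(pos nums m).
by rewrite ltnNge leq_addr /= addKn nth_cat size_enc_nat jm.
Qed.

Lemma mark_at nums m i : m < size nums -> i <= size (bits (nth 0 nums m)) ->
  nth false (encs nums) (pos nums m + i.*2) = (i < size (bits (nth 0 nums m))).
Proof. by move=> mN le; rewrite nth_encs ?nth_enc_nat_mark //; lia. Qed.

Lemma bit_at nums m i : m < size nums -> i < size (bits (nth 0 nums m)) ->
  nth false (encs nums) (pos nums m + i.*2.+1) = odd (nth 0 nums m %/ 2 ^ i).
Proof. by move=> mN le; rewrite nth_encs ?nth_enc_nat_bit ?nth_bits //; lia. Qed.

Lemma size_encs nums : 2 * size nums <= size (encs nums).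
Proof.
elim: nums => //= a s IH; rewrite /encs /= size_cat size_enc_nat.
by move: IH; rewrite /encs; lia.
Qed.

Section Reading.

Variables (nums : seq nat) (R M : nat).
Local Notation x := (encs nums).
Hypotheses (R30 : 30 <= R) (xM : size x <= M).

Local Notation runs := (runs x R).
Local Notation Inc := (Inc R).
Local Notation Dec := (Dec R).
Local Notation For := (For R).
Local Notation Clear := (Clear R).
Local Notation Move := (Move R).
Local Notation pos := (pos nums).
Local Notation num := (nth 0 nums).
Local Notation nbits m := (size (bits (num m))).

Lemma nbits_le m : m < size nums -> (nbits m).*2.+2 <= M.
Proof.
move=> mN; apply: leq_trans xM; rewrite (encs_split mN) size_cat size_cat size_enc_nat.
by lia.
Qed.

Lemma runs_adv_in m i s p p' : m < size nums -> i <= (nbits m).*2 ->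
  p = pos m + i -> p' = p.+1 -> runs Adv (s, p) (s, p') 1.
Proof.
by move=> mN im -> ->; apply: runs_adv; rewrite -addnS pos_lt.
Qed.

Definition Skip := WhileBit (Adv ;; Adv) ;; Adv ;; Adv.

(** The loop passes the marked pairs and the last two moves pass the end pair. A next number must
    exist because the head may not leave the input. *)
Lemma runs_skip s m : m.+1 < size nums ->
  runs Skip (s, pos m) (s, pos m.+1) (M * 3 + 3).
Proof.
move=> mN; have mN' := ltnW mN.
apply: (@runs_le _ _ _ _ _ ((nbits m * 3).+1 + (1 + 1))).
  by have := nbits_le mN'; lia.
apply: (@runs_seq _ _ _ _ _ (s, pos m + (nbits m).*2)).
  have := @runs_whilebit x R (Adv ;; Adv) (fun i => (s, pos m + i.*2)) (nbits m) 2.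
  rewrite /= addn0; apply; last by rewrite mark_at ?ltnn.
  move=> j jm; rewrite mark_at ?jm //; last exact: ltnW.
  split=> //; apply: (@runs_seq _ _ _ _ _ (s, pos m + j.*2.+1) _ 1 1).
    by apply: (@runs_adv_in m (j.*2)) => //; lia.
  by apply: (@runs_adv_in m (j.*2.+1)) => //; lia.
apply: (@runs_seq _ _ _ _ _ (s, pos m + (nbits m).*2.+1)).
  by apply: (@runs_adv_in m ((nbits m).*2)) => //; lia.
have E : pos m.+1 = (pos m + (nbits m).*2.+1).+1 by rewrite posS // !addnS.
by rewrite E; apply: runs_adv; rewrite -E -[pos _]addn0 pos_lt.
Qed.

(** The body must work for all values of [r] and [z], since these two are split while the loop
    runs. *)
Lemma runs_for_skip r z Q s m w c : r < R -> z < R -> r <> z -> s z = 0 ->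
  s r <= M -> m + s r * w < size nums ->
  (forall s' m', (forall q, q <> r -> q <> z -> s' q = s q) ->
     m' + w < size nums -> runs Q (s', pos m') (s', pos (m' + w)) c) ->
  runs (For r z Q) (s, pos m) (s, pos (m + s r * w)) (M * (c + 6) + 2).
Proof.
move=> rR zR rz sz srM lt H.
apply: (@runs_le _ _ _ _ _ (s r * (c + 6)).+2).
  by rewrite addn2 !ltnS leq_mul2r srM orbT.
have := @runs_for x R r z Q (fun j => (s, pos (m + j * w))) (s r) c rR zR rz.
rewrite /= mul0n addn0; apply=> // j jr; rewrite mulSnr addnA; apply: H.
  by move=> q qr qz; upd_tac.
by apply: leq_ltn_trans lt; rewrite -addnA -mulSnr leq_add2l leq_mul2r jr orbT.
Qed.

Local Notation rpw := 15.
Local Notation rtmp := 16.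

(** Before bit [i], [rpw] holds [2 ^ i] and [d] the value of the lower bits. [rtmp] is first a loop
    index, then the target of the doubling. *)
Definition ReadLoop d :=
  WhileBit (Adv ;; IfBit (For rpw rtmp (Inc d)) Nop ;;
    WhileNZ rpw (Dec rpw ;; Inc rtmp ;; Inc rtmp) ;; Move rtmp rpw ;; Adv).

Definition Read d := Inc rpw ;; ReadLoop d ;; Clear rpw ;; Rew.

Definition cost_read := M * (M * 20 + 20) + M * 4 + 10.

(** The value bound [num m <= M] is what makes reading into unary polynomial. *)
Lemma runs_read d s m : d < R -> d <> rpw -> d <> rtmp ->
  s rpw = 0 -> s rtmp = 0 -> s d = 0 ->
  m < size nums -> num m <= M ->
  runs (Read d) (s, pos m) (upd s d (num m), 0) cost_read.
Proof.
move=> dR dp dt sp stmp sd mN mM.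
set v := num m; set n := nbits m.
pose S i : st := (upd (upd s rpw (2 ^ i)) d (v %% 2 ^ i), pos m + i.*2).
(* The last doubling goes one past the top bit: at most twice the value, or 1 when the value is
   0. *)
have le2 : 2 ^ n <= M * 2 + 1.
  case E: n => [|n'] //; first by lia.
  have : 2 ^ n' <= v by apply: size_bits_ltn; rewrite -/n E.
  by rewrite expnS /v; lia.
apply: (@runs_le _ _ _ _ _ (1 + ((n * (M * 20 + 16).+1).+1 + ((M * 2 + 1) * 2).+1 + 1))).
  have := nbits_le mN; rewrite -/n /cost_read => nM.
  have : n * (M * 20 + 16).+1 <= M * (M * 20 + 20) by apply: leq_mul; lia.
  by lia.
apply: (@runs_seq _ _ _ _ _ (S 0)).
  rewrite /S addn0; apply: runs_inc_to; first by lia.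
  by rewrite /= modn1; upd_tac.
rewrite -addnA; apply: (@runs_seq _ _ _ _ _ (S n)).
  apply: runs_whilebit => [i iN|]; last by rewrite /= mark_at ?ltnn.
  rewrite /S /= mark_at ?iN; try lia; split=> //.
  have iv : 2 ^ i <= v by apply: size_bits_ltn.
  apply: (@runs_le _ _ _ _ _ (1 + ((v * 7).+2.+1 + ((2 ^ i * 4).+1 + ((2 ^ i.+1 * 3).+1 + 1))))).
    by rewrite /v in iv *; rewrite expnS; lia.
  apply: (@runs_seq _ _ _ _ _ (upd (upd s rpw (2 ^ i)) d (v %% 2 ^ i), pos m + i.*2.+1)).
    by apply: (@runs_adv_in m (i.*2)) => //; lia.
  apply: (@runs_seq _ _ _ _ _ (upd (upd s rpw (2 ^ i)) d (v %% 2 ^ i.+1), pos m + i.*2.+1)).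
    apply: runs_ifbit; rewrite /= bit_at // -/v modn_exp2S.
    case: odd; rewrite ?mul0n ?mul1n ?add0n; last by apply: runs_nop_to.
    apply: (@runs_le _ _ _ _ _ (2 ^ i * (1 + 6)).+2); first by lia.
    have := @runs_for x R rpw rtmp (Inc d)
      (fun j => (upd (upd s rpw (2 ^ i)) d (j + v %% 2 ^ i), pos m + i.*2.+1)) (2 ^ i) 1.
    apply; try lia; try by upd_tac.
    by move=> j ji; apply: runs_inc_to => //; upd_tac.
  apply: (@runs_seq _ _ _ _ _ (upd (upd (upd s rpw 0) rtmp (2 ^ i.+1)) d (v %% 2 ^ i.+1), pos m + i.*2.+1)).
    have := @runs_whilenz x R rpw (Dec rpw ;; Inc rtmp ;; Inc rtmp)
      (fun j => (upd (upd (upd s rpw (2 ^ i - j)) rtmp j.*2) d (v %% 2 ^ i.+1), pos m + i.*2.+1)) (2 ^ i) 3.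
    rewrite subn0 subnn /= -[(2 ^ i).*2]mul2n -expnS => H.
    have -> : upd (upd s rpw (2 ^ i)) d (v %% 2 ^ i.+1) =
      upd (upd (upd s rpw (2 ^ i)) rtmp 0) d (v %% 2 ^ i.+1) by upd_tac.
    apply: H; try lia; last by upd_tac.
    move=> j ji; split; first by upd_tac.
    apply: (@runs_seq _ _ _ _ _ _ _ 1 2).
      by apply: runs_dec => //; try lia; upd_tac.
    apply: (@runs_seq _ _ _ _ _ _ _ 1 1).
      by apply: runs_inc => //; lia.
    by apply: runs_inc_to; try lia; upd_tac.
  apply: (@runs_seq _ _ _ _ _ (upd (upd s rpw (2 ^ i.+1)) d (v %% 2 ^ i.+1), pos m + i.*2.+1)).
    by apply: runs_move_to; upd_tac.
  by apply: (@runs_adv_in m (i.*2.+1)) => //; lia.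
have vn : v %% 2 ^ n = v by rewrite modn_small // bits_bound.
apply: (@runs_seq _ _ _ _ _ (upd s d v, (S n).2)); last exact: runs_rew.
by apply: runs_clear_to; rewrite ?vn; upd_tac.
Qed.

(** * Comparing a binary number with a unary count *)

Local Notation rc := 17.
Local Notation rh := 18.
Local Notation rpar := 19.
Local Notation rfl := 20.

Definition Halve :=
  WhileNZ rc (Dec rc ;; IfNZ rc (Dec rc ;; Inc rh) (Inc rpar)) ;; Move rh rc.

Lemma runs_halve s p : s rh = 0 -> s rpar = 0 -> s rc <= M ->
  runs Halve (s, p) (upd (upd s rc (s rc)./2) rpar (odd (s rc)), p) (M * 8 + 10).
Proof.
move=> sh sp scM; set C := s rc in scM *.
(* For odd [C] the last of the [uphalf C] rounds finds only one unit; it raises [rpar] instead of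
   [rh]. *)
pose S j : st := (upd (upd (upd s rc (C - j.*2)) rh (minn j C./2)) rpar
                  (odd C && (C < j.*2)), p).
apply: (@runs_le _ _ _ _ _ ((uphalf C * 5).+1 + (M * 3).+1)); first by lia.
apply: (@runs_seq _ _ _ _ _ (S (uphalf C))).
  have -> : (s, p) = S 0 by congr pair; rewrite /S andbF; upd_tac.
  apply: runs_whilenz; first by lia.
    move=> j jC; rewrite /S /=; split; first by upd_tac.
    apply: (@runs_seq _ _ _ _ _ _ _ 1 3).
      by apply: runs_dec => //; try lia; upd_tac.
    apply: runs_ifnz; first by lia.
    case: ifP => H.
      apply: (@runs_seq _ _ _ _ _ _ _ 1 1); first by apply: runs_dec => //; lia.
      by apply: runs_inc_to; [lia|upd_hyp H].
    by apply: (@runs_le _ _ _ _ _ 1) => //; apply: runs_inc_to; [lia|upd_hyp H].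
  by rewrite /S; upd_tac.
by apply: runs_move_to; rewrite /S; upd_tac.
Qed.

(** Halving [rc] yields the bits of the count in the order in which the input yields those of the
    number. Equal bits leave the verdict [rfl] unchanged. *)
Definition LeLoop :=
  WhileBit (Adv ;; Halve ;;
    IfBit (IfNZ rpar (Dec rpar) (Clear rfl))
          (IfNZ rpar (Dec rpar ;; Clear rfl ;; Inc rfl) Nop) ;; Adv).

Definition NumLeCount := Inc rfl ;; LeLoop ;; IfNZ rc (Clear rc ;; Clear rfl ;; Inc rfl) Nop ;; Rew.

Definition cost_le := M * (M * 8 + 30) + M * 4 + 20.

(** Only the count has to be at most [M]; the number enters the cost through its bit length
    alone. *)
Lemma runs_numlecount s m : s rh = 0 -> s rpar = 0 -> s rfl = 0 -> s rc <= M ->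
  m < size nums ->
  runs NumLeCount (s, pos m) (upd (upd s rc 0) rfl (num m <= s rc), 0) cost_le.
Proof.
move=> sh sp sf scM mN.
set v := num m; set n := nbits m; set C := s rc in scM *.
pose S i : st := (upd (upd s rc (C %/ 2 ^ i)) rfl (v %% 2 ^ i <= C %% 2 ^ i),
                  pos m + i.*2).
apply: (@runs_le _ _ _ _ _ (1 + ((n * (M * 8 + 20).+1).+1 + (M * 2 + 8 + 1)))).
  have := nbits_le mN; rewrite -/n /cost_le => nM.
  have : n * (M * 8 + 20).+1 <= M * (M * 8 + 30) by apply: leq_mul; lia.
  by lia.
apply: (@runs_seq _ _ _ _ _ (S 0)).
  by rewrite /S addn0 divn1 !modn1; apply: runs_inc_to; [lia|upd_tac].
apply: (@runs_seq _ _ _ _ _ (S n)).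
  apply: runs_whilebit => [i iN|]; last by rewrite /= mark_at ?ltnn.
  rewrite /S /= mark_at ?iN; try lia; split=> //.
  set s1 := upd (upd s rc _) rfl _.
  have s1C : s1 rc <= M.
    by rewrite /s1; upd_tac; apply: leq_trans (leq_div _ _) scM.
  apply: (@runs_le _ _ _ _ _ (1 + ((M * 8 + 10) + (7 + 1)))); first by lia.
  apply: (@runs_seq _ _ _ _ _ (s1, pos m + i.*2.+1)).
    by apply: (@runs_adv_in m (i.*2)) => //; lia.
  apply: (@runs_seq _ _ _ _ _ _ _ (M * 8 + 10)).
    by apply: runs_halve => //; rewrite /s1; upd_tac.
  apply: (@runs_seq _ _ _ _ _ ((S i.+1).1, pos m + i.*2.+1)).
    have h : (C %/ 2 ^ i)./2 = C %/ 2 ^ i.+1 by rewrite expnSr divnMA divn2.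
    have s1E : s1 rc = C %/ 2 ^ i by rewrite /s1; upd_tac.
    apply: runs_ifbit; rewrite /= bit_at // -/v s1E h leq_modn_exp2S /s1.
    case: (odd (v %/ _)); case E: (odd (C %/ _)) => /=;
      apply: runs_ifnz; try lia; rewrite /= ?updE /=.
    - by apply: (@runs_le _ _ _ _ _ 1) => //; apply: runs_dec_to; upd_tac.
    - by apply: runs_clear_to; try lia; upd_tac; case: (_ <= _).
    - apply: (@runs_seq _ _ _ _ _ _ _ 1 4).
        by apply: runs_dec => //; try lia; upd_tac.
      apply: (@runs_seq _ _ _ _ _ _ _ 3 1).
        by apply: runs_clear_to; [lia|reflexivity|]; upd_tac; case: (_ <= _).
      by apply: runs_inc_to; upd_tac.
    - by apply: runs_nop_to; upd_tac.
  by apply: (@runs_adv_in m (i.*2.+1)) => //; lia.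
apply: (@runs_seq _ _ _ _ _ (upd (upd s rc 0) rfl (v <= C), (S n).2)); last exact: runs_rew.
rewrite (leq_div_mod C (bits_bound v)) -/n.
apply: (@runs_le _ _ _ _ _ ((M * 2).+1 + (3 + 1)).+1); first by lia.
apply: runs_ifnz; first by lia.
have -> : (S n).1 rc = C %/ 2 ^ n by rewrite /S; upd_tac.
case: posnP => E /=.
  by apply: runs_nop_to; rewrite /S E; upd_tac.
apply: (@runs_seq _ _ _ _ _ _ _ (M * 2).+1).
  apply: runs_clear_to; [lia|reflexivity|]; rewrite /S; upd_tac.
  have := leq_div C (2 ^ n); lia.
apply: (@runs_seq _ _ _ _ _ _ _ 3).
  by apply: runs_clear_to; [lia|reflexivity|]; rewrite /S; upd_tac; case: (_ <= _).
by apply: runs_inc_to; rewrite /S; upd_tac.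
Qed.

End Reading.

(** * The enumeration program *)

Definition agree (D : seq nat) (s s' : nat -> nat) :=
  forall q, q \notin D -> s' q = s q.

Lemma agree_upd r s v : agree [:: r] s (upd s r v).
Proof. by move=> q; rewrite inE /upd => /negbTE ->. Qed.

Definition regs (L : seq (nat * nat)) (s : nat -> nat) :=
  forall r v, (r, v) \in L -> s r = v.

Lemma regs_agree D L s s' : all (fun p => p.1 \notin D) L ->
  agree D s s' -> regs L s -> regs L s'.
Proof. by move=> /allP LD ag H r v rv; rewrite ag ?(LD _ rv) //; apply: H. Qed.

Lemma regs_sub L L' s : {subset L' <= L} -> regs L s -> regs L' s.
Proof. by move=> sub H r v /sub; apply: H. Qed.

Lemma regs_catl L L' s : regs (L ++ L') s -> regs L s.
Proof. by apply: regs_sub => y; rewrite mem_cat => ->. Qed.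

Section Algorithm.

Variables (pol : bool) (T : nat).
Local Notation R := (30 + 2 * T).

(* A loop splits its bound counter between rounds done and rounds left, so n and
   the layer counts are kept in several copies: suffix A for addressing, the
   others for one loop each. *)
Local Notation rbad := 0.
Local Notation rnA := 1.
Local Notation rnB := 2.
Local Notation rnV := 3.
Local Notation rv := 4.
Local Notation rnU := 5.
Local Notation ru := 6.
Local Notation rk1A := 7.
Local Notation rk2A := 8.
Local Notation rk1L := 9.
Local Notation rk2L := 10.
Local Notation ri := 11.
Local Notation z1 := 12.
Local Notation z2 := 13.
Local Notation z3 := 14.
Local Notation rc := 17.
Local Notation rfl := 20.
Local Notation rm := 23.
Local Notation rg1 := 24.
Local Notation rg2 := 25.
Local Notation re := 26.
Local Notation abound j := (30 + 2 * j).
Local Notation areg j := (31 + 2 * j).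

Local Notation Inc := (Inc R).
Local Notation Dec := (Dec R).
Local Notation For := (For R).
Local Notation Clear := (Clear R).
Local Notation IfEq := (IfEq R).

Definition SkipNums r := For r z1 Skip.
Definition SkipRow := For rnA z2 Skip.
Definition SkipRows r := For r z1 SkipRow.
Definition SkipLayers r := For r z1 (For rnB z3 SkipRow).

Definition Base2 := Skip ;; Skip ;; SkipLayers rk1A ;; SkipRows rk1A.
Definition Base (b : bool) := if b then Base2 ;; Skip else Skip ;; Skip.

Definition GotoAdj b := Base b ;; SkipLayers ri ;; SkipRows rv ;; SkipNums ru.
Definition GotoThr b :=
  Base b ;; SkipLayers (if b then rk2A else rk1A) ;; SkipRows ri ;; SkipNums rv.

(** Tuple entries may repeat, so [rm] can exceed 1; only its being nonzero matters. *)
Fixpoint Member t :=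
  if t is t'.+1 then Member t' ;; IfEq (areg t') ru (Inc rm) Nop else Nop.

(** The first mark of an encoded number is true iff the number is positive, so an adjacency entry is
    tested without being read. [rc] always counts ones; for [pol = true] these are the nodes outside
    the tuple. *)
Definition NeighborBody b :=
  GotoAdj b ;; IfBit (Inc re) Nop ;; Rew ;; IfEq ru rv (Inc re) Nop ;;
  IfNZ re (Clear re ;; Member T ;;
    (if pol then IfNZ rm (Clear rm) (Inc rc) else IfNZ rm (Clear rm ;; Inc rc) Nop)) Nop.

Definition LayerBody b g :=
  For rnU ru (NeighborBody b) ;; GotoThr b ;; NumLeCount R ;;
  (if pol then IfNZ rfl (Dec rfl) (Inc g) else IfNZ rfl (Dec rfl ;; Inc g) Nop).

Definition CountFired b g := For (if b then rk2L else rk1L) ri (LayerBody b g).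

Definition VertexBody :=
  CountFired false rg1 ;; CountFired true rg2 ;;
  IfNZ rg1 (IfNZ rg2 Nop (Inc rbad)) (IfNZ rg2 (Inc rbad) Nop) ;;
  Clear rg1 ;; Clear rg2.

(** The bounds are [n.+1], not [n]: the extra value [n] is the padding entry. *)
Fixpoint Enum t :=
  if t is t'.+1 then For (abound t') (areg t') (Enum t') else For rnV rv VertexBody.

Fixpoint ReadBounds t :=
  if t is t'.+1 then ReadBounds t' ;; Read R (abound t') ;; Inc (abound t') else Nop.

(* For n = 0 the layer counts may be exponential in the input size and must not
   be read. *)
Definition Program :=
  Read R rnA ;; IfNZ rnA
    (Read R rnB ;; Read R rnV ;; Read R rnU ;; ReadBounds T ;;
     (Skip ;; Read R rk1A) ;; (Skip ;; Read R rk1L) ;;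
     (Base2 ;; Read R rk2A) ;; (Base2 ;; Read R rk2L) ;; Enum T) Nop.

Variables (nums : seq nat) (n k1 k2 M : nat).
Local Notation x := (encs nums).
Local Notation runs := (runs x R).
Local Notation pos := (pos nums).
Local Notation num := (nth 0 nums).

Definition kk (b : bool) := if b then k2 else k1.
(* Position of the second layer count in the list of encoded numbers. *)
Definition base2 := 2 + k1 * (n * n) + k1 * n.
Definition off (b : bool) := if b then base2.+1 else 2.

(** Pure index arithmetic on a list of numbers, so that the program is verified without mentioning
    any system; [adjN_adj] and [thrN_thr] make the link later. *)
Definition adjN b i v u := num (off b + i * (n * n) + v * n + u).
Definition thrN b i v := num (off b + kk b * (n * n) + i * n + v).

Hypotheses (xM : size x <= M) (nM : n < M) (k1M : k1 <= M) (k2M : k2 <= M).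
Hypotheses (num_n : num 0 = n) (num_k1 : num 1 = k1) (num_k2 : num base2 = k2).
Hypothesis size_nums : size nums = base2.+1 + k2 * (n * n) + k2 * n.

Lemma R30 : 30 <= R.
Proof. exact: leq_addr. Qed.

Definition memb (A : nat -> nat) y := has (fun j => A j == y) (iota 0 T).

Definition nb A b i v u : bool :=
  ((u == v) || (0 < adjN b i v u)) && (memb A u (+) pol).
Definition cnt A b i v := \sum_(0 <= u < n) nb A b i v u.
Definition lay A b v i : bool := (thrN b i v <= cnt A b i v) (+) pol.
Definition num_fired A b v := \sum_(0 <= i < kk b) lay A b v i.
Definition mismatch A v : bool := (0 < num_fired A false v) != (0 < num_fired A true v).

(** The number of disagreements over pairs of a tuple and a node, in the recursion pattern of
    [Enum]. *)
Fixpoint nbad t (A : nat -> nat) :=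
  if t is t'.+1 then \sum_(0 <= a < n.+1) nbad t' (upd A t' a)
  else \sum_(0 <= v < n) mismatch A v.

Definition fixed_regs :=
  [:: (rnA, n); (rnB, n); (rk1A, k1); (rk2A, k2)] ++
  [seq (r, 0) | r <- [:: z1; z2; z3; 18; 19; 21; 22]].

(** What addressing and membership tests rely on; any change confined to [free] registers keeps
    it. *)
Definition inv A s := regs fixed_regs s /\
  forall j, j < T -> s (areg j) = A j /\ A j <= M.

Definition free (r : nat) := (r < 30) && (r \notin unzip1 fixed_regs).

Lemma inv_agree D A s s' : agree D s s' -> all free D -> inv A s -> inv A s'.
Proof.
move=> ag /allP fD [H1 H2]; split.
  apply: regs_agree ag H1; apply/allP => -[r v] rv /=; apply/negP => /fD /andP [_].
  by case/negP; apply: (map_f fst rv).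
move=> j jT; rewrite ag; first exact: H2.
by apply/negP => /fD /andP [H _]; lia.
Qed.

Definition cfor c := M * (c + 6) + 2.
Definition cskip := M * 3 + 3.
Definition cbase := 3 * cskip + cfor (cfor (cfor cskip)) + cfor (cfor cskip).
Definition cgoto := cbase + cfor (cfor (cfor cskip)) + cfor (cfor cskip) + cfor cskip.

Local Ltac reg H := by apply: H; rewrite !inE ?eqxx ?orbT.

(** * Positioning the head at an adjacency entry or a threshold *)

Section Addressing.

Variables (A s : nat -> nat).
Hypothesis invs : inv A s.

Lemma inv_regs : [/\ s rnA = n, s rnB = n, s rk1A = k1 & s rk2A = k2].
Proof. case: invs => H _; split; reg H. Qed.

Lemma inv_zeros : [/\ s z1 = 0, s z2 = 0 & s z3 = 0] /\
  [/\ s 18 = 0, s 19 = 0, s 21 = 0 & s 22 = 0].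
Proof. by case: invs => H _; split; split; reg H. Qed.

End Addressing.

Lemma runs_skiprow s m : s rnA = n -> s z2 = 0 -> m + n < size nums ->
  runs SkipRow (s, pos m) (s, pos (m + n)) (cfor cskip).
Proof.
move=> sA s2 lt.
have := @runs_for_skip nums R M rnA z2 Skip s m 1 cskip.
rewrite sA muln1; apply; try lia.
by move=> s' m' _; rewrite addn1; apply: (runs_skip (M := M)).
Qed.

Lemma runs_skipnums s m r : r < R -> r <> z1 -> s z1 = 0 -> s r <= M ->
  m + s r < size nums ->
  runs (SkipNums r) (s, pos m) (s, pos (m + s r)) (cfor cskip).
Proof.
move=> rR rz sz sM lt.
have := @runs_for_skip nums R M r z1 Skip s m 1 cskip.
rewrite muln1; apply; try lia.
by move=> s' m' _; rewrite addn1; apply: (runs_skip (M := M)).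
Qed.

Lemma runs_skiprows s m r : r < R -> r <> z1 -> r <> rnA -> r <> z2 ->
  s z1 = 0 -> s rnA = n -> s z2 = 0 -> s r <= M -> m + s r * n < size nums ->
  runs (SkipRows r) (s, pos m) (s, pos (m + s r * n)) (cfor (cfor cskip)).
Proof.
move=> rR r1 rA r2 s1 sA s2 sM lt.
have := @runs_for_skip nums R M r z1 SkipRow s m n (cfor cskip).
apply; try lia.
by move=> s' m' fr lt'; apply: runs_skiprow => //; rewrite fr; lia.
Qed.

Lemma runs_skiplayers s m r :
  r < R -> r <> z1 -> r <> rnA -> r <> z2 -> r <> rnB -> r <> z3 ->
  s z1 = 0 -> s rnA = n -> s z2 = 0 -> s rnB = n -> s z3 = 0 -> s r <= M ->
  m + s r * (n * n) < size nums ->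
  runs (SkipLayers r) (s, pos m) (s, pos (m + s r * (n * n))) (cfor (cfor (cfor cskip))).
Proof.
move=> rR r1 rA r2 rB r3 s1 sA s2 sB s3 sM lt.
have := @runs_for_skip nums R M r z1 (For rnB z3 SkipRow) s m (n * n) (cfor (cfor cskip)).
apply; try lia.
move=> s' m' fr lt'.
have E : s' rnB = n by rewrite fr; lia.
have := @runs_for_skip nums R M rnB z3 SkipRow s' m' n (cfor cskip).
rewrite E; apply; try lia; first by rewrite fr; lia.
by move=> s2' m2 fr2 lt2; apply: runs_skiprow => //; rewrite fr2 ?fr; lia.
Qed.

Lemma base2_bounds : 2 <= base2 < size nums.
Proof. by rewrite size_nums /base2; lia. Qed.

Lemma runs_base2 s : s rnA = n -> s rnB = n -> s rk1A = k1 ->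
  s z1 = 0 -> s z2 = 0 -> s z3 = 0 ->
  runs Base2 (s, pos 0) (s, pos base2) (cbase - cskip).
Proof.
move=> sA sB s1 sz1 sz2 sz3.
have /andP [b2 b2N] := base2_bounds.
apply: (@runs_le _ _ _ _ _ (cskip + (cskip + (cfor (cfor (cfor cskip)) + cfor (cfor cskip))))).
  by rewrite /cbase; lia.
apply: runs_seq; first by apply: (runs_skip (M := M)); lia.
apply: runs_seq; first by apply: (runs_skip (M := M)); lia.
have e : base2 = 2 + s rk1A * (n * n) + s rk1A * n by rewrite s1.
rewrite e; apply: runs_seq; first by apply: runs_skiplayers; lia.
by apply: runs_skiprows; lia.
Qed.

(** With no matrix entries the target could lie past the last number, outside the input;
    [0 < kk b * n] excludes this. *)
Lemma runs_base A s b : inv A s ->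
  0 < kk b * n -> runs (Base b) (s, pos 0) (s, pos (off b)) cbase.
Proof.
have /andP [b2 b2N] := base2_bounds.
move=> I; case: b => /= kn; last first.
  apply: (@runs_le _ _ _ _ _ (cskip + cskip)); first by rewrite /cbase; lia.
  by apply: runs_seq; apply: (runs_skip (M := M)); lia.
apply: (@runs_le _ _ _ _ _ (cbase - cskip + cskip)); first by rewrite /cbase; lia.
apply: runs_seq.
  have [sA sB s1 s2] := inv_regs I; have [[sz1 sz2 sz3] _] := inv_zeros I.
  exact: runs_base2.
by apply: (runs_skip (M := M)); lia.
Qed.

(** Every intermediate stop on the way to an entry must itself be the start of a number, hence the
    list of bounds. *)
Lemma index_bound b i v u : i < kk b -> v < n -> u < n ->
  [/\ off b + i * (n * n) < size nums, off b + i * (n * n) + v * n < size nums,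
      off b + i * (n * n) + v * n + u < size nums,
      off b + kk b * (n * n) + i * n < size nums &
      off b + kk b * (n * n) + i * n + v < size nums].
Proof.
move=> ik vn un.
have h1 : v * n + u < n * n by nia.
have h2 : i * (n * n) + n * n <= kk b * (n * n) by rewrite -mulSnr leq_mul2r ik orbT.
have h3 : i * n + n <= kk b * n by rewrite -mulSnr leq_mul2r ik orbT.
have h4 : off b + kk b * (n * n) + kk b * n <= size nums.
  by rewrite size_nums /base2; case: b {ik h2 h3} => /=; rewrite /base2; lia.
by split; lia.
Qed.

Lemma runs_gotoadj A s b : inv A s -> s ri < kk b -> s rv < n -> s ru < n ->
  runs (GotoAdj b) (s, pos 0)
    (s, pos (off b + s ri * (n * n) + s rv * n + s ru)) cgoto.
Proof.
move=> I ik vn un; have [sA sB s1 s2] := inv_regs I; have [[sz1 sz2 sz3] _] := inv_zeros I.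
have [b1 b2 b3 _ _] := index_bound ik vn un.
have kM : kk b <= M by case: (b).
apply: (@runs_le _ _ _ _ _ (cbase + (cfor (cfor (cfor cskip)) +
  (cfor (cfor cskip) + cfor cskip)))); first by rewrite /cgoto; lia.
apply: runs_seq.
  by apply: runs_base I _; case: (kk b) ik => //; nia.
apply: runs_seq; first by apply: runs_skiplayers; lia.
apply: runs_seq; first by apply: runs_skiprows; lia.
by apply: runs_skipnums; lia.
Qed.

Lemma runs_gotothr A s b : inv A s -> s ri < kk b -> s rv < n ->
  runs (GotoThr b) (s, pos 0)
    (s, pos (off b + kk b * (n * n) + s ri * n + s rv)) cgoto.
Proof.
move=> I ik vn; have [sA sB s1 s2] := inv_regs I; have [[sz1 sz2 sz3] _] := inv_zeros I.
have [_ _ _ b4 b5] := index_bound ik vn vn.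
have kM : kk b <= M by case: (b).
have e : kk b = s (if b then rk2A else rk1A) by case: (b).
apply: (@runs_le _ _ _ _ _ (cbase + (cfor (cfor (cfor cskip)) +
  (cfor (cfor cskip) + cfor cskip)))); first by rewrite /cgoto; lia.
apply: runs_seq.
  by apply: runs_base I _; case: (kk b) ik => //; nia.
apply: (@runs_seq _ _ _ _ _ (s, pos (off b + kk b * (n * n)))).
  by rewrite e; apply: runs_skiplayers; try (by case: (b)); rewrite -?e //; try lia; case: (b); lia.
apply: runs_seq; first by apply: runs_skiprows; lia.
by apply: runs_skipnums; lia.
Qed.

(** * Bodies of the nested loops *)

Lemma inv_upd A s r v : free r -> inv A s -> inv A (upd s r v).
Proof. by move=> fr I; apply: (inv_agree (@agree_upd r s v) _ I); rewrite /= fr. Qed.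

Lemma runs_member A s p t : inv A s -> t <= T -> s ru <= M ->
  runs (Member t) (s, p)
    (upd s rm (s rm + count (fun j => A j == s ru) (iota 0 t)), p)
    (t * (M * 14 + 21)).
Proof.
move=> I; elim: t => [|t IH] tT uM.
  by rewrite /= addn0 upd_same; apply: runs_nop.
rewrite [t.+1 * _]mulSnr; apply: runs_seq; first by apply: IH; rewrite // ltnW.
set s1 := upd s rm _.
have I1 : inv A s1 by apply: inv_upd I.
have [_ [_ _ s21 s22]] := inv_zeros I1; have [[s12 _ _] _] := inv_zeros I1.
have [at_ aM] := I1.2 t tT.
have -> : M * 14 + 21 = M * 14 + 1 + 20 by lia.
apply: runs_ifeq => //; rewrite /scratch ?at_; try lia.
rewrite -[t.+1]addn1 iotaD count_cat /= addn0 addnA add0n.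
have -> : s1 ru = s ru by rewrite /s1; upd_tac.
case: eqP => _.
  by apply: runs_inc_to; [lia|rewrite /s1; upd_tac].
by apply: runs_nop_to; rewrite /s1; upd_tac.
Qed.

Definition cneighbor := cgoto + T * (M * 14 + 21) + M * 14 + T * 2 + 50.

Lemma runs_neighbor A s b : inv A s -> regs [:: (re, 0); (rm, 0)] s ->
  s ri < kk b -> s rv < n -> s ru < n ->
  runs (NeighborBody b) (s, 0)
    (upd s rc (s rc + nb A b (s ri) (s rv) (s ru)), 0) cneighbor.
Proof.
move=> I Z ik vn un.
have e0 : s re = 0 by reg Z.
have m0 : s rm = 0 by reg Z.
have [_ _ lt _ _] := index_bound ik vn un.
apply: (@runs_le _ _ _ _ _ (cgoto + (2 + (1 + ((M * 14 + 1 + 20) +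
  (5 + (T * (M * 14 + 21) + (T * 2 + 3))).+1))))).
  by rewrite /cneighbor; lia.
apply: runs_seq; first by have := runs_gotoadj I ik vn un; rewrite pos0; apply.
set w := adjN b (s ri) (s rv) (s ru).
apply: (@runs_seq _ _ _ _ _ (upd s re (0 < w), pos (off b + s ri * (n * n) + s rv * n + s ru))).
  apply: runs_ifbit; have := mark_at lt (leq0n _); rewrite addn0 => /= ->.
  rewrite size_bits_gt0 -[num _]/w.
  case: ifP => _; first by apply: runs_inc_to; [lia|upd_tac].
  by apply: runs_nop_to; upd_tac.
apply: runs_seq; first exact: runs_rew.
set s1 := upd s re (0 < w).
have I1 : inv A s1 by apply: inv_upd I.
have [_ [_ _ s21 s22]] := inv_zeros I1; have [[s12 _ _] _] := inv_zeros I1.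
apply: (@runs_seq _ _ _ _ _ (upd s re ((0 < w) + (s ru == s rv)), 0)).
  apply: runs_ifeq; rewrite ?/s1; try lia; try by upd_tac.
  have -> : (s1 ru == s1 rv) = (s ru == s rv) by rewrite /s1; upd_tac.
  case: eqP => _; first by apply: runs_inc_to; [lia|upd_tac].
  by apply: runs_nop_to; upd_tac.
apply: runs_ifnz; first by lia.
rewrite /= updE; case: ifP => E; last first.
  rewrite /nb -/w; have -> : (s ru == s rv) || (0 < w) = false by move: E; case: (0 < w); case: (s ru == s rv).
  by apply: runs_nop_to; upd_tac.
have Et : (s ru == s rv) || (0 < w) by move: E; case: (0 < w); case: (s ru == s rv).
apply: (@runs_seq _ _ _ _ _ (s, 0)).
  by apply: runs_clear_to; [lia|upd_tac|rewrite updE; case: (0 < w); case: (s ru == s rv)].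
apply: runs_seq; first by apply: runs_member I _ _; lia.
rewrite /nb -/w Et /=; have -> : memb A (s ru) = (0 < count (fun j => A j == s ru) (iota 0 T)).
  by rewrite /memb has_count.
have := count_size (fun j => A j == s ru) (iota 0 T); rewrite size_iota m0.
move: (count _ _) => k kT.
case: (pol).
  apply: (@runs_le _ _ _ _ _ (k * 2).+1.+1); first by lia.
  apply: runs_ifnz; first by lia.
  rewrite /= updE add0n; case: posnP => k0 /=.
    by apply: (@runs_le _ _ _ _ _ 1); [lia|apply: runs_inc_to; [lia|upd_tac]].
  by apply: runs_clear_to; upd_tac.
apply: (@runs_le _ _ _ _ _ ((k * 2).+1 + 1).+1); first by lia.
apply: runs_ifnz; first by lia.
rewrite /= updE add0n; case: posnP => k0 /=.
  by apply: runs_nop_to; upd_tac.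
apply: (@runs_seq _ _ _ _ _ (s, 0)); first by apply: runs_clear_to; upd_tac.
by apply: runs_inc_to; [lia|upd_tac].
Qed.

(** Every loop from the neighbours up to the tuples has the net effect of adding to one register, so
    a single rule turns each into a sum. The body may meet any value of the accumulator. *)
Lemma runs_for_acc r t p acc (f : nat -> nat) N s c :
  r < R -> t < R -> r <> t -> acc <> r -> acc <> t -> s r = N -> s t = 0 ->
  (forall j s', j < N -> s' t = j -> agree [:: r; t; acc] s s' ->
     runs p (s', 0) (upd s' acc (s' acc + f j), 0) c) ->
  runs (For r t p) (s, 0) (upd s acc (s acc + \sum_(0 <= j < N) f j), 0)
    (N * (c + 6)).+2.
Proof.
move=> rR tR rt ar at_ sr st H.
have := @runs_for x R r t p
  (fun i => (upd s acc (s acc + \sum_(0 <= j < i) f j), 0)) N c.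
rewrite big_geq // addn0 upd_same /=; apply => //; try by upd_tac.
move=> j jN; rewrite big_nat_recr //=.
set s1 := upd (upd (upd s acc _) r _) t j.
have := H j s1 jN; rewrite /s1 updE => /(_ erefl).
have -> : forall q, upd (upd (upd s acc q) r (N - j.+1)) t j acc = q by move=> q; upd_tac.
move=> K; have -> : upd (upd (upd s acc (s acc + (\sum_(0 <= i < j) f i + f j))) r (N - j.+1)) t j =
  upd s1 acc (s acc + \sum_(0 <= j0 < j) f j0 + f j) by rewrite /s1; upd_tac.
apply: K => q; rewrite !inE !negb_or => /and3P [/eqP qr /eqP qt /eqP qa].
by upd_tac.
Qed.

(** The requirements [regsU], [regsL], [regsG], [regsV], [regsE] grow with the nesting: each level
    adds its own counters to those of the levels inside it. *)
Definition regsU := [:: (rnU, n); (ru, 0); (re, 0); (rm, 0)].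

Lemma runs_count A s b : inv A s -> regs regsU s -> s ri < kk b -> s rv < n ->
  runs (For rnU ru (NeighborBody b)) (s, 0)
    (upd s rc (s rc + cnt A b (s ri) (s rv)), 0) (cfor cneighbor).
Proof.
move=> I Z ik vn.
have nU : s rnU = n by reg Z.
have u0 : s ru = 0 by reg Z.
apply: (@runs_le _ _ _ _ _ (n * (cneighbor + 6)).+2).
  by rewrite /cfor addn2 !ltnS leq_mul2r ltnW ?orbT.
apply: runs_for_acc; try lia.
move=> j s' jn uj ag.
have [vE iE] : s' rv = s rv /\ s' ri = s ri by split; rewrite ag.
have := @runs_neighbor A s' b; rewrite vE iE uj; apply=> //.
  exact: inv_agree ag _ I.
by apply: (regs_agree _ ag) => //; apply: regs_sub Z => y; rewrite !inE => /orP [] -> ; rewrite ?orbT.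
Qed.

Definition regsL := regsU ++ [:: (rc, 0); (rfl, 0)].
Definition clayer := cfor cneighbor + cgoto + cost_le M + 5.

Lemma cnt_le A b i v : cnt A b i v <= n.
Proof.
rewrite /cnt -{2}[n]subn0 -[n - 0]muln1 -sum_nat_const_nat.
by apply: leq_sum => u _; apply: leq_b1.
Qed.

Lemma runs_layer A s b g : inv A s -> regs regsL s -> s ri < kk b -> s rv < n ->
  g < 30 -> 23 < g ->
  runs (LayerBody b g) (s, 0) (upd s g (s g + lay A b (s rv) (s ri)), 0) clayer.
Proof.
move=> I Z ik vn g30 g23.
have c0 : s rc = 0 by reg Z.
have f0 : s rfl = 0 by reg Z.
have [_ _ _ _ lt] := index_bound ik vn vn.
apply: (@runs_le _ _ _ _ _ (cfor cneighbor + (cgoto + (cost_le M + 3)))).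
  by rewrite /clayer; lia.
apply: runs_seq.
  by apply: runs_count I _ _ _ => //; apply: regs_catl Z.
rewrite c0 add0n; set s1 := upd s rc _.
have I1 : inv A s1 by apply: inv_upd I.
have [[_ _ _] [h1 h2 _ _]] := inv_zeros I1.
apply: runs_seq.
  by have := @runs_gotothr A s1 b I1; rewrite pos0; apply; rewrite /s1; upd_tac.
have [vE iE] : s1 rv = s rv /\ s1 ri = s ri by split; rewrite /s1; upd_tac.
have cE : s1 rc = cnt A b (s ri) (s rv) by rewrite /s1 updE.
rewrite vE iE; apply: runs_seq.
  apply: runs_numlecount => //.
  by rewrite cE; have := cnt_le A b (s ri) (s rv); lia.
rewrite cE -/(thrN b (s ri) (s rv)) /lay.
set d := thrN _ _ _ <= cnt _ _ _ _.
case: (pol).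
  apply: runs_ifnz; first by lia.
  rewrite /= updE; case: (d) => /=.
    by apply: (@runs_le _ _ _ _ _ 1) => //; apply: runs_dec_to; rewrite /s1; upd_tac.
  by apply: (@runs_le _ _ _ _ _ 1) => //; apply: runs_inc_to; rewrite /s1; upd_tac.
apply: runs_ifnz; first by lia.
rewrite /= updE; case: (d) => /=; last by apply: runs_nop_to; rewrite /s1; upd_tac.
apply: (@runs_seq _ _ _ _ _ (s, 0) _ 1 1); first by apply: runs_dec_to; rewrite /s1; upd_tac.
by apply: runs_inc_to; rewrite /s1; upd_tac.
Qed.

Definition regsG := regsL ++ [:: (rk1L, k1); (rk2L, k2); (ri, 0)].

Lemma runs_fired A s b g : inv A s -> regs regsG s -> s rv < n ->
  g < 30 -> 23 < g -> g \notin unzip1 regsG ->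
  runs (CountFired b g) (s, 0) (upd s g (s g + num_fired A b (s rv)), 0) (cfor clayer).
Proof.
move=> I Z vn g30 g23 gZ.
have iz : s ri = 0 by reg Z.
have e : s (if b then rk2L else rk1L) = kk b by case: (b); reg Z.
have kM : kk b <= M by case: (b).
apply: (@runs_le _ _ _ _ _ (kk b * (clayer + 6)).+2).
  by rewrite /cfor addn2 !ltnS leq_mul2r kM ?orbT.
apply: runs_for_acc; rewrite ?e //; try (case: (b); lia).
move=> j s' jk ij ag.
have vE : s' rv = s rv.
  by apply: ag; rewrite !inE; case: (b); lia.
have := @runs_layer A s' b g; rewrite vE ij; apply=> //.
  apply: (inv_agree ag _ I); rewrite /free /=; move: gZ; rewrite /= !inE.
  by case: (b) => /=; lia.
apply: (@regs_agree _ regsL _ _ _ ag); last by apply: regs_catl Z.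
by move: gZ; rewrite /= !inE; case: (b) => /=; lia.
Qed.

Definition regsV := regsG ++ [:: (rg1, 0); (rg2, 0)].
Definition cvertex := 2 * cfor clayer + M * 4 + 10.

Lemma num_fired_le A b v : num_fired A b v <= M.
Proof.
apply: (@leq_trans (kk b)); last by case: (b).
rewrite /num_fired -{2}[kk b]subn0 -[kk b - 0]muln1 -sum_nat_const_nat.
by apply: leq_sum => u _; apply: leq_b1.
Qed.

Lemma runs_vertex A s : inv A s -> regs regsV s -> s rv < n ->
  runs VertexBody (s, 0) (upd s rbad (s rbad + mismatch A (s rv)), 0) cvertex.
Proof.
move=> I Z vn.
have g10 : s rg1 = 0 by reg Z.
have g20 : s rg2 = 0 by reg Z.
apply: (@runs_le _ _ _ _ _ (cfor clayer + (cfor clayer + (3 + ((M * 2).+1 + (M * 2).+1))))).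
  by rewrite /cvertex; lia.
have ZG : regs regsG s by apply: regs_catl Z.
apply: runs_seq; first by apply: runs_fired I ZG _ _ _ _.
rewrite g10 add0n; set s1 := upd s rg1 _.
have I1 : inv A s1 by apply: inv_upd I.
have ZG1 : regs regsG s1 by apply: regs_agree (@agree_upd rg1 s _) ZG.
have vE : s1 rv = s rv by rewrite /s1; upd_tac.
have gE : s1 rg2 = 0 by rewrite /s1; upd_tac.
apply: runs_seq; first by apply: runs_fired I1 ZG1 _ _ _ _; rewrite ?vE.
rewrite vE gE add0n /mismatch.
have t1 := num_fired_le A false (s rv); have t2 := num_fired_le A true (s rv).
rewrite /s1; move: (num_fired _ false _) (num_fired _ true _) t1 t2 => a b aM bM.
pose d : bool := (0 < a) != (0 < b).
apply: (@runs_seq _ _ _ _ _ (upd (upd (upd s rg1 a) rg2 b) rbad (s rbad + d), 0)).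
  apply: runs_ifnz; first by lia.
  rewrite /= -[upd _ rg2 b rg1]/a.
  rewrite /d; case: posnP => a0 /=; apply: runs_ifnz; try lia; rewrite /= updE;
    case: posnP => b0 /=; try (by apply: runs_nop_to; upd_tac);
    by apply: runs_inc_to; [lia|upd_tac].
apply: (@runs_seq _ _ _ _ _ (upd (upd s rg2 b) rbad (s rbad + d), 0)).
  by apply: runs_clear_to; upd_tac.
by apply: runs_clear_to; upd_tac.
Qed.

Definition regsE := regsV ++ [:: (rnV, n); (rv, 0)].

Definition bounds t (s : nat -> nat) :=
  forall j, j < t -> s (abound j) = n.+1 /\ s (areg j) = 0.

Fixpoint cenum t := if t is t'.+1 then cfor (cenum t') else cfor cvertex.

Lemma runs_enum t A s : t <= T -> inv A s -> regs regsE s -> bounds t s ->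
  runs (Enum t) (s, 0) (upd s rbad (s rbad + nbad t A), 0) (cenum t).
Proof.
elim: t A s => [|t IH] A s tT I Z B.
  have nV : s rnV = n by reg Z.
  have v0 : s rv = 0 by reg Z.
  apply: (@runs_le _ _ _ _ _ (n * (cvertex + 6)).+2).
    by rewrite /= /cfor addn2 !ltnS leq_mul2r ltnW ?orbT.
  apply: runs_for_acc; try lia.
  move=> j s' jn vj ag.
  have := @runs_vertex A s'; rewrite vj; apply=> //.
    exact: inv_agree ag _ I.
  by apply: (@regs_agree _ regsV _ _ _ ag) => //; apply: regs_catl Z.
have [bt at_] := B t (ltnSn t).
apply: (@runs_le _ _ _ _ _ (n.+1 * (cenum t + 6)).+2).
  by rewrite /= /cfor addn2 !ltnS leq_mul2r nM ?orbT.
apply: runs_for_acc; try lia.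
move=> a s' an sa ag.
have free30 r : r < 30 -> r != rbad -> s' r = s r.
  by move=> r30 r0; apply: ag; rewrite !inE (negbTE r0); lia.
have other j : j <> t -> s' (abound j) = s (abound j) /\ s' (areg j) = s (areg j).
  by move=> jt; split; apply: ag; rewrite !inE; lia.
apply: IH; first exact: ltnW.
- split.
    move=> r v rv_; rewrite free30; first exact: I.1.
      by move: rv_; rewrite !inE !xpair_eqE; lia.
    by move: rv_; rewrite !inE !xpair_eqE; lia.
  move=> j jT; rewrite /upd; case: eqP => [->|jt]; first by rewrite sa; lia.
  by have [_ ->] := other j jt; apply: I.2.
- move=> r v rv_; rewrite free30; first exact: Z.
    by move: rv_; rewrite !inE !xpair_eqE; lia.
  by move: rv_; rewrite !inE !xpair_eqE; lia.
- by move=> j jt; have [-> ->] := other j (ltac:(lia)); apply: B; lia.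
Qed.

(** From 30 on, even registers hold loop bounds and odd ones tuple entries. *)
Definition with_bounds t (s : nat -> nat) y :=
  if [&& 30 <= y, y < 30 + 2 * t & ~~ odd y] then n.+1 else s y.

Lemma runs_readbounds t s : t <= T -> s 15 = 0 -> s 16 = 0 ->
  (forall j, j < t -> s (abound j) = 0) ->
  runs (ReadBounds t) (s, 0) (with_bounds t s, 0) (t * (cost_read M + 1)).
Proof.
move=> tT s15 s16; elim: t tT => [|t IH] tT B.
  by apply: runs_nop_to; apply: functional_extensionality => y; rewrite /with_bounds; case: ifP; lia.
rewrite [t.+1 * _]mulSnr; apply: runs_seq.
  by apply: IH => [|j jt]; [apply: ltnW|apply: B; apply: ltnW].
have lt : 0 < size nums by rewrite size_nums; lia.
have rd := @runs_read nums R M R30 xM (abound t) (with_bounds t s) 0.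
rewrite num_n pos0 in rd; apply: runs_seq.
  apply: rd => //; try lia.
  by rewrite /with_bounds; case: ifP => [H|_]; [lia|apply: B].
apply: runs_inc_to; first by lia.
apply: functional_extensionality => y; rewrite /with_bounds /upd eqxx.
by case: eqP => [->|ne]; do ?[case: ifP]; lia.
Qed.

Definition cprogram :=
  8 * cost_read M + T * (cost_read M + 1) + 2 * cskip + 2 * cbase + cenum T + 10.

Lemma runs_program : 0 < n -> exists s',
  runs Program (fun=> 0, 0) (s', 0) cprogram /\ s' rbad = nbad T (fun=> 0).
Proof.
move=> n0.
have /andP [b2 b2N] := base2_bounds.
have rd d s m := @runs_read nums R M R30 xM d s m.
pose s1 := upd (fun=> 0) rnA n.
pose s2 := upd s1 rnB n.
pose s3 := upd s2 rnV n.
pose s4 := upd s3 rnU n.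
pose s5 := with_bounds T s4.
pose s6 := upd s5 rk1A k1.
pose s7 := upd s6 rk1L k1.
pose s8 := upd s7 rk2A k2.
pose s9 := upd s8 rk2L k2.
have R' := R30.
exists (upd s9 rbad (s9 rbad + nbad T (fun=> 0))); split; last by rewrite updE.
apply: (@runs_le _ _ _ _ _ (cost_read M + (cost_read M + (cost_read M + (cost_read M +
  (T * (cost_read M + 1) + ((cskip + cost_read M) + ((cskip + cost_read M) +
  ((cbase - cskip + cost_read M) + ((cbase - cskip + cost_read M) + cenum T)))))))).+1)).
  by rewrite /cprogram; lia.
have rd_n d s : d < R -> d <> 15 -> d <> 16 -> s 15 = 0 -> s 16 = 0 -> s d = 0 ->
    runs (Read R d) (s, 0) (upd s d n, 0) (cost_read M).
  move=> h1 h2 h3 h4 h5 h6; have := rd d s 0; rewrite num_n pos0; apply => //; lia.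
have rd_k1 d s : d < R -> d <> 15 -> d <> 16 -> s 15 = 0 -> s 16 = 0 -> s d = 0 ->
    runs (Skip ;; Read R d) (s, 0) (upd s d k1, 0) (cskip + cost_read M).
  move=> h1 h2 h3 h4 h5 h6; apply: runs_seq.
    by have := @runs_skip nums R M R30 xM s 0; rewrite pos0; apply; lia.
  by have := rd d s 1; rewrite num_k1; apply => //; lia.
have rd_k2 d s : d < R -> d <> 15 -> d <> 16 -> s 15 = 0 -> s 16 = 0 -> s d = 0 ->
    s rnA = n -> s rnB = n -> s rk1A = k1 -> s z1 = 0 -> s z2 = 0 -> s z3 = 0 ->
    runs (Base2 ;; Read R d) (s, 0) (upd s d k2, 0) (cbase - cskip + cost_read M).
  move=> h1 h2 h3 h4 h5 h6 sA sB sk sz1 sz2 sz3; apply: runs_seq.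
    by have := runs_base2 sA sB sk sz1 sz2 sz3; rewrite pos0; apply.
  by have := rd d s base2; rewrite num_k2; apply => //; lia.
apply: runs_seq; first by apply: rd_n.
apply: runs_ifnz; first by [].
rewrite [_.1 _]/= n0.
apply: runs_seq; first by apply: rd_n.
apply: runs_seq; first by apply: rd_n.
apply: runs_seq; first by apply: rd_n.
apply: runs_seq; first by apply: runs_readbounds => // j _; rewrite /upd /=; case: ifP => //; lia.
apply: runs_seq; first by apply: rd_k1.
apply: runs_seq; first by apply: rd_k1.
apply: runs_seq; first by apply: rd_k2.
apply: runs_seq; first by apply: rd_k2.
rewrite -/s1 -/s2 -/s3 -/s4 -/s5 -/s6 -/s7 -/s8 -/s9.
apply: runs_enum => //.
- split=> [r v|j jT].
    by rewrite !inE => H; repeat (case/orP: H => H); move/eqP: H => [-> ->].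
  split=> //; rewrite /s9 /s8 /s7 /s6 /s5 /with_bounds /s4 /s3 /s2 /s1 /upd.
  by do ?[case: ifP]; lia.
- move=> r v.
  by rewrite !inE => H; repeat (case/orP: H => H); move/eqP: H => [-> ->].
- move=> j jT; split; rewrite /s9 /s8 /s7 /s6 /s5 /with_bounds /s4 /s3 /s2 /s1 /upd;
    by do ?[case: ifP]; lia.
Qed.

End Algorithm.

(** * Small supports and the encoding *)

Lemma size_flatten_unif (U : Type) (ss : seq (seq U)) w :
  all (fun s => size s == w) ss -> size (flatten ss) = size ss * w.
Proof. by elim: ss => //= s ss IH /andP [/eqP sw /IH]; rewrite size_cat sw => ->. Qed.

(** Row-major addressing; used for the layers, for the rows of a matrix and for the thresholds. *)
Lemma nth_flatten_unif (U : Type) (y : U) (ss : seq (seq U)) w i j :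
  all (fun s => size s == w) ss -> i < size ss -> j < w ->
  nth y (flatten ss) (i * w + j) = nth y (nth [::] ss i) j.
Proof.
elim: ss i => //= s ss IH [|i] /andP [/eqP sw all_w] ik jw.
  by rewrite nth_cat sw jw.
by rewrite nth_cat sw mulSn -addnA ltnNge leq_addr /= addKn IH.
Qed.

Section Encoding.

Variables (n : nat) (S : tmsyds n).
Local Notation k := (nlayers S).

Let rows (i : 'I_k) := [seq [seq nat_of_bool (adj S i u v) | v <- enum 'I_n] | u <- enum 'I_n].
Let layers := [seq flatten (rows i) | i <- enum 'I_k].
Let thrs := [seq [seq thr S i v | v <- enum 'I_n] | i <- enum 'I_k].

Lemma rows_unif i : all (fun s => size s == n) (rows i).
Proof. by apply/allP => s /mapP [u _ ->]; rewrite size_map size_enum_ord. Qed.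

Lemma size_rows i : size (flatten (rows i)) = n * n.
Proof. by rewrite (size_flatten_unif (rows_unif i)) size_map size_enum_ord. Qed.

Lemma layers_unif : all (fun s => size s == n * n) layers.
Proof. by apply/allP => s /mapP [i _ ->]; rewrite size_rows. Qed.

Lemma size_layers : size (flatten layers) = k * (n * n).
Proof. by rewrite (size_flatten_unif layers_unif) size_map size_enum_ord. Qed.

Lemma thrs_unif : all (fun s => size s == n) thrs.
Proof. by apply/allP => s /mapP [u _ ->]; rewrite size_map size_enum_ord. Qed.

Lemma nats_of_tmsydsE : nats_of_tmsyds S = k :: flatten layers ++ flatten thrs.
Proof. by []. Qed.

Lemma size_nats_of_tmsyds : size (nats_of_tmsyds S) = (k * (n * n) + k * n).+1.
Proof.
rewrite nats_of_tmsydsE /= size_cat size_layers (size_flatten_unif thrs_unif).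
by rewrite size_map size_enum_ord.
Qed.

Lemma nth_adj (i : 'I_k) (v u : 'I_n) :
  nth 0 (nats_of_tmsyds S) (i * (n * n) + v * n + u).+1 = adj S i v u.
Proof.
have un := ltn_ord u; have vn := ltn_ord v; have ik := ltn_ord i.
have vu : v * n + u < n * n by nia.
have : i * (n * n) + n * n <= k * (n * n) by rewrite -mulSnr leq_mul2r ik orbT.
rewrite nats_of_tmsydsE /= nth_cat size_layers => le.
rewrite -addnA; case: ltnP; last by lia.
move=> _; rewrite (nth_flatten_unif _ layers_unif) //; last by rewrite size_map size_enum_ord.
rewrite (nth_map i) ?size_enum_ord // nth_ord_enum.
rewrite (nth_flatten_unif _ (rows_unif i)) //; last by rewrite size_map size_enum_ord.
rewrite (nth_map v) ?size_enum_ord // nth_ord_enum.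
by rewrite (nth_map u) ?size_enum_ord // nth_ord_enum.
Qed.

Lemma nth_thr (i : 'I_k) (v : 'I_n) :
  nth 0 (nats_of_tmsyds S) (k * (n * n) + i * n + v).+1 = thr S i v.
Proof.
rewrite nats_of_tmsydsE /= nth_cat size_layers -addnA ltnNge leq_addr /= addKn.
rewrite (nth_flatten_unif _ thrs_unif) //; last by rewrite size_map size_enum_ord.
rewrite (nth_map i) ?size_enum_ord // nth_ord_enum.
by rewrite (nth_map v) ?size_enum_ord // nth_ord_enum.
Qed.

End Encoding.

Section SmallSupports.

Variables (n : nat) (pol : bool).

Definition nbhd (S : tmsyds n) (i : 'I_(nlayers S)) (v : 'I_n) : {set 'I_n} :=
  [set u | (u == v) || adj S i v u].

(* For pol = true (AND masters) zeros play the role of ones: the layer outputs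
   0 as soon as the closed neighbourhood contains trigger many zeros. *)
Definition trigger (S : tmsyds n) (i : 'I_(nlayers S)) v :=
  if pol then #|nbhd i v|.+1 - thr S i v else thr S i v.

Definition fires (S : tmsyds n) (B : {set 'I_n}) v :=
  [exists i, trigger i v <= #|B :&: @nbhd S i v|].

(** For [pol = true], ones and zeros share the closed neighbourhood, so too few ones means enough
    zeros. Truncated subtraction is right: a threshold above the neighbourhood size makes the layer
    constantly 0, and a trigger 0 always fires. *)
Lemma threshold_trigger (S : tmsyds n) (i : 'I_(nlayers S)) v (B : {set 'I_n}) :
  (thr S i v <= #|[set u in nbhd i v | (u \in B) (+) pol]|) (+) pol =
  (trigger i v <= #|B :&: nbhd i v|).
Proof.
rewrite /trigger; case: pol; last first.
  rewrite addbF; congr (_ <= #|pred_of_set _|).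
  by apply/setP => u; rewrite !inE addbF andbC.
have -> : [set u in nbhd i v | (u \in B) (+) true] = nbhd i v :\: B.
  by apply/setP => u; rewrite !inE addbT andbC.
have := cardsID B (nbhd i v); rewrite setIC.
by lia.
Qed.

Lemma fires_mono S (B B' : {set 'I_n}) v : B \subset B' -> fires S B v -> fires S B' v.
Proof.
move=> BB /existsP [i le]; apply/existsP; exists i.
by apply: leq_trans le (subset_leq_card _); apply: setSI.
Qed.

(** Firing is an existential over layers, so one layer and [trigger] many points of its closed
    neighbourhood suffice as a witness. *)
Lemma fires_small S (B : {set 'I_n}) v T : (forall i, @trigger S i v <= T) -> fires S B v ->
  exists B' : {set 'I_n}, [/\ B' \subset B, #|B'| <= T & fires S B' v].
Proof.
move=> trT /existsP [i le].
set D := B :&: nbhd i v in le.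
pose B' : {set 'I_n} := [set u in take (trigger i v) (enum D)].
have B'D : B' \subset D.
  by apply/subsetP => u; rewrite inE => /mem_take; rewrite mem_enum.
have card_B' : #|B'| = trigger i v.
  by rewrite cardsE (card_uniqP _) ?take_uniq ?enum_uniq // size_takel -?cardE.
exists B'; split; first by apply: subset_trans B'D (subsetIl _ _).
  by rewrite card_B'.
apply/existsP; exists i; rewrite -card_B'; apply: subset_leq_card.
by rewrite subsetI subxx (subset_trans B'D) ?subsetIr.
Qed.

(** Shrink to a small witness for one system, transfer it to the other, and enlarge again by
    monotonicity. *)
Lemma fires_eq_small S1 S2 T :
  (forall i v, @trigger S1 i v <= T) -> (forall i v, @trigger S2 i v <= T) ->
  (forall (B : {set 'I_n}) v, #|B| <= T -> fires S1 B v = fires S2 B v) ->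
  forall B v, fires S1 B v = fires S2 B v.
Proof.
move=> tr1 tr2 H B v; apply/idP/idP => /fires_small.
  case/(_ T) => [i|B' [BB B'T]]; first exact: tr1.
  by rewrite H //; apply: fires_mono.
case/(_ T) => [i|B' [BB B'T]]; first exact: tr2.
by rewrite -H //; apply: fires_mono.
Qed.

(** [psiE] holds for OR with [pol = false] and, by De Morgan, for AND with [pol = true]. *)
Variable psi : seq bool -> bool.
Hypothesis psiE : forall s, psi s (+) pol = has (fun b => b (+) pol) s.

Lemma local_valE (S : tmsyds n) i v (C : config n) :
  local_val S i v C = (thr S i v <= #|[set u in nbhd i v | C u]|).
Proof.
rewrite /local_val /threshold_fun; congr (_ <= _).
rewrite count_map /cnbhd count_filter -sum1_count -sum1_card big_enum_cond.
by apply: eq_bigl => u; rewrite /= !inE andbC.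
Qed.

Lemma succ_fires S (C : config n) v :
  succ psi S C v = fires S [set u | C u (+) pol] v (+) pol.
Proof.
rewrite ffunE -[LHS](addbK pol) psiE; congr (_ (+) _).
have key i : local_val S i v C (+) pol =
    (trigger i v <= #|[set u | C u (+) pol] :&: nbhd i v|).
  rewrite local_valE -threshold_trigger; congr ((_ <= _) (+) _).
  by apply: eq_card => u; rewrite !inE addbK.
rewrite has_map; apply/hasP/existsP => [[i _ Hi]|[i Hi]]; exists i.
- by rewrite -key.
- by rewrite mem_enum.
- by rewrite /= key.
Qed.

(** Sets and configurations correspond bijectively through the xor with [pol], which also cancels on
    the outputs. *)
Lemma equivalent_fires S1 S2 :
  equivalent psi S1 S2 <-> forall B v, fires S1 B v = fires S2 B v.
Proof.
split=> [E B v|E C]; last by apply/ffunP => v; rewrite !succ_fires E.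
pose C : config n := [ffun u => (u \in B) (+) pol].
have CB : [set u | C u (+) pol] = B by apply/setP => u; rewrite !inE ffunE addbK.
have := congr1 (fun D : config n => D v) (E C).
by rewrite !succ_fires CB => /addIb.
Qed.

End SmallSupports.

(** Induction on the nesting depth gathers the loop values into one function [A'], which agrees with
    [A] from [t] on because only the entries below [t] are looped over. *)
Lemma nbad_eq0 pol T nums n k1 k2 t A :
  nbad pol T nums n k1 k2 t A = 0 <->
  forall A', (forall j, j < t -> A' j <= n) -> (forall j, t <= j -> A' j = A j) ->
  forall v, v < n -> ~~ mismatch pol T nums n k1 k2 A' v.
Proof.
have sum0 N (f : nat -> nat) :
    \sum_(0 <= a < N) f a = 0 <-> forall a, a < N -> f a = 0.
  rewrite big_mkord; split=> [/eqP|H].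
    rewrite sum_nat_eq0 => /forallP H a aN.
    by apply/eqP; apply: (H (Ordinal aN)).
  by apply: big1 => i _; apply: H.
elim: t A => [|t IH] A /=; rewrite sum0.
  split=> [H A' _ eq v vn|H v vn].
    have -> : A' = A by apply: functional_extensionality => j; apply: eq.
    by rewrite -eqb0; apply/eqP; apply: H.
  by apply/eqP; rewrite eqb0; apply: H.
split=> [H A' le eq v vn|H a an].
  have /IH := H (A' t) (le t (ltnSn t)); apply=> //.
    by move=> j jt; apply: le; apply: ltnW.
  move=> j; rewrite leq_eqVlt /upd => /orP [/eqP <-|tj]; first by rewrite eqxx.
  by case: eqP => [->|_] //; apply: eq.
apply/IH => A' le eq v vn; apply: H => // j.
  rewrite ltnS leq_eqVlt => /orP [/eqP ->|]; last exact: le.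
  by rewrite eq // updE.
by move=> jt; rewrite eq ?(ltnW jt) // /upd; case: eqP jt => // ->; rewrite ltnn.
Qed.

(** * The number of disagreements in terms of the encoded systems *)

Section Correctness.

Variables (pol : bool) (T n : nat) (S1 S2 : tmsyds n).
Let S (b : bool) := if b then S2 else S1.
Local Notation k1 := (nlayers S1).
Local Notation k2 := (nlayers S2).

Definition numbers := n :: nats_of_tmsyds S1 ++ nats_of_tmsyds S2.
Local Notation nums := numbers.

Lemma nth_nums_1 m : m < (k1 * (n * n) + k1 * n).+1 ->
  nth 0 nums m.+1 = nth 0 (nats_of_tmsyds S1) m.
Proof.
rewrite -[nth 0 nums _]/(nth 0 (nats_of_tmsyds S1 ++ nats_of_tmsyds S2) m) => lt.
by rewrite nth_cat size_nats_of_tmsyds lt.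
Qed.

Lemma nth_nums_2 m : nth 0 nums (base2 n k1 + m) = nth 0 (nats_of_tmsyds S2) m.
Proof.
have -> : base2 n k1 + m = (size (nats_of_tmsyds S1) + m).+1.
  by rewrite size_nats_of_tmsyds /base2; lia.
set j := _ + m; rewrite -[LHS]/(nth 0 (nats_of_tmsyds S1 ++ nats_of_tmsyds S2) j).
by rewrite nth_cat /j ltnNge leq_addr addKn.
Qed.

Lemma adjN_adj b (i : 'I_(nlayers (S b))) (v u : 'I_n) :
  adjN nums n k1 b i v u = adj (S b) i v u.
Proof.
rewrite -nth_adj /adjN /off; case: b i => i.
  by apply: etrans (nth_nums_2 _); congr nth; lia.
apply: etrans (nth_nums_1 _); first by congr nth; lia.
have un := ltn_ord u; have vn := ltn_ord v; have ik := ltn_ord i.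
have vu : v * n + u < n * n by nia.
have : i * (n * n) + n * n <= k1 * (n * n) by rewrite -mulSnr leq_mul2r ik orbT.
by lia.
Qed.

Lemma thrN_thr b (i : 'I_(nlayers (S b))) (v : 'I_n) :
  thrN nums n k1 k2 b i v = thr (S b) i v.
Proof.
rewrite -nth_thr /thrN /off /kk; case: b i => i; lazy beta iota.
  have kE : nlayers (S true) = k2 by [].
  by apply: etrans (nth_nums_2 _); congr nth; lia.
apply: etrans (nth_nums_1 _); first by congr nth; lia.
have vn := ltn_ord v; have ik : i < k1 := ltn_ord i.
have : i * n + n <= k1 * n by rewrite -mulSnr leq_mul2r ik orbT.
by rewrite -[nlayers (S false)]/k1; lia.
Qed.

Definition mset A : {set 'I_n} := [set u : 'I_n | memb T A u].

Lemma lay_trigger A b (i : 'I_(nlayers (S b))) (v : 'I_n) :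
  lay pol T nums n k1 k2 A b v i = (trigger pol i v <= #|mset A :&: nbhd i v|).
Proof.
rewrite -threshold_trigger /lay thrN_thr; congr ((_ <= _) (+) _).
rewrite /cnt big_mkord -sum1_card [RHS]big_mkcond /=; apply: eq_bigr => u _.
by rewrite /nb adjN_adj !inE lt0b -val_eqE /=; case: ifP.
Qed.

Lemma num_fired_fires A b (v : 'I_n) :
  (0 < num_fired pol T nums n k1 k2 A b v) = fires pol (S b) (mset A) v.
Proof.
have -> : num_fired pol T nums n k1 k2 A b v =
    \sum_(i < nlayers (S b)) lay pol T nums n k1 k2 A b v i.
  by rewrite /num_fired /kk; case: b; rewrite big_mkord.
rewrite lt0n sum_nat_eq0 negb_forall; apply: eq_existsb => i /=.
by rewrite lay_trigger; case: (_ <= _).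
Qed.

Lemma nbad_fires :
  nbad pol T nums n k1 k2 T (fun=> 0) = 0 <->
  forall (B : {set 'I_n}) v, #|B| <= T -> fires pol S1 B v = fires pol S2 B v.
Proof.
have mismatchE A (v : 'I_n) : mismatch pol T nums n k1 k2 A v =
    (fires pol S1 (mset A) v != fires pol S2 (mset A) v).
  by rewrite /mismatch !num_fired_fires.
(* A set is listed as a tuple with default [n], which is no node and pads sets of fewer than [T]
   elements; from [T] on the entries must be those of the initial zero tuple. *)
rewrite nbad_eq0; split=> [H B v BT|H A le eq v vn].
  pose A j := if j < T then nth n [seq val u | u <- enum B] j else 0.
  have AB : mset A = B.
    apply/setP => u; rewrite inE; apply/hasP/idP => [[j]|uB].
      rewrite mem_iota add0n /A => /andP [_ ->] /eqP Aj.
      have jB : j < size (enum B).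
        by rewrite ltnNge; apply/negP => le; move: Aj (ltn_ord u);
          rewrite nth_default ?size_map // => <-; rewrite ltnn.
      by move: Aj; rewrite (nth_map u) // => /val_inj <-; rewrite -mem_enum mem_nth.
    have uB' : u \in enum B by rewrite mem_enum.
    have jB : index u (enum B) < size (enum B) by rewrite index_mem.
    have jT : index u (enum B) < T by apply: leq_trans jB _; rewrite -cardE.
    exists (index u (enum B)); first by rewrite mem_iota.
    by rewrite /A jT (nth_map u) // nth_index.
  suff : ~~ mismatch pol T nums n k1 k2 A v by rewrite mismatchE AB negbK => /eqP.
  apply: H => // j.
    move=> jT; rewrite /A jT; case: (ltnP j (size (enum B))) => jB.
      by rewrite (nth_map v) //; apply/ltnW/ltn_ord.
    by rewrite nth_default ?size_map.
  by rewrite /A leqNgt => /negbTE ->.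
rewrite (mismatchE A (Ordinal vn)) H ?eqxx //.
(* Conversely, the nodes named by a tuple are distinct values among its [T] entries, so there are at
   most [T] of them. *)
rewrite cardE -(size_map (@nat_of_ord n)) -[leqRHS](size_iota 0) -[leqRHS](size_map A).
apply: uniq_leq_size; first by rewrite (map_inj_uniq (@ord_inj n)) enum_uniq.
move=> y /mapP [u]; rewrite mem_enum inE => /hasP [j jT /eqP <-] ->.
exact: map_f.
Qed.

End Correctness.

(** * Running time *)

(** The base [m.+1] is positive, so powers grow with the exponent and two bounds can be merged by
    adding exponents. *)
Definition polybound (f : nat -> nat) :=
  exists c d, forall m, f m <= c * m.+1 ^ d.

Lemma polybound_const a : polybound (fun=> a).
Proof. by exists a, 0 => m; rewrite muln1. Qed.

Lemma polybound_id : polybound id.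
Proof. by exists 1, 1 => m; rewrite mul1n expn1. Qed.

Lemma polyboundD f g : polybound f -> polybound g -> polybound (fun m => f m + g m).
Proof.
move=> [c1 [d1 H1]] [c2 [d2 H2]]; exists (c1 + c2), (d1 + d2) => m.
rewrite mulnDl leq_add //.
  by apply: leq_trans (H1 m) _; rewrite leq_mul2l leq_pexp2l ?leq_addr ?orbT.
by apply: leq_trans (H2 m) _; rewrite leq_mul2l leq_pexp2l ?leq_addl ?orbT.
Qed.

Lemma polyboundM f g : polybound f -> polybound g -> polybound (fun m => f m * g m).
Proof.
move=> [c1 [d1 H1]] [c2 [d2 H2]]; exists (c1 * c2), (d1 + d2) => m.
by rewrite expnD mulnACA leq_mul.
Qed.

Ltac polybound_tac :=
  repeat first
    [ assumption | apply: polybound_const | apply: polybound_id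
    | apply: polyboundD | apply: polyboundM ].

Lemma polybound_cfor f : polybound f -> polybound (fun m => cfor m (f m)).
Proof. by move=> Hf; rewrite /cfor; polybound_tac. Qed.

Lemma polybound_cprogram T : polybound (cprogram T).
Proof.
have Hskip : polybound cskip by rewrite /cskip; polybound_tac.
have Hrow := polybound_cfor Hskip; have Hrows := polybound_cfor Hrow.
have Hlayers := polybound_cfor Hrows.
have Hbase : polybound cbase by rewrite /cbase; polybound_tac.
have Hgoto : polybound cgoto by rewrite /cgoto; polybound_tac.
have Hread : polybound cost_read by rewrite /cost_read; polybound_tac.
have Hle : polybound cost_le by rewrite /cost_le; polybound_tac.
have Hnb : polybound (cneighbor T) by rewrite /cneighbor; polybound_tac.
have Hcount := polybound_cfor Hnb.
have Hlayer : polybound (clayer T) by rewrite /clayer; polybound_tac.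
have Hfired := polybound_cfor Hlayer.
have Hvertex : polybound (cvertex T) by rewrite /cvertex; polybound_tac.
have Henum t : polybound (fun m => cenum T m t).
  by elim: t => [|t IH]; apply: polybound_cfor.
by have := Henum T; rewrite /cprogram => ?; polybound_tac.
Qed.

(** The bound of [program_decides] for [30 + 2 * T] counters and verdict register 0; the strict
    inequality there turns 6 into 7. *)
Definition tm_time T m :=
  7 + (cprogram T m * ((6 * (30 + 2 * T).+1 + 24) * (cprogram T m + m + 1)) + 4).

Lemma polybound_tm_time T : polybound (tm_time T).
Proof. by have := polybound_cprogram T; rewrite /tm_time => ?; polybound_tac. Qed.

Lemma tm_decides_within_mono M x t t' P :
  t <= t' -> tm_decides_within M x t P -> tm_decides_within M x t' P.
Proof.
rewrite /tm_decides_within => tt' [H1 H2].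
suff -> : iter t' (@tm_step M) (tm_init M x) = iter t (@tm_step M) (tm_init M x) by [].
rewrite -(subnK tt') iterD; elim: (t' - t) => //= k ->.
by move: H1; case: (iter _ _ _) => q l h r /= ->.
Qed.

Lemma equivalence_decidable (pol : bool) (psi : seq bool -> bool) T :
  (forall s, psi s (+) pol = has (fun b => b (+) pol) s) ->
  exists (M : TM) (c d : nat), forall (n : nat) (S1 S2 : tmsyds n),
    wf_tmsyds S1 -> wf_tmsyds S2 ->
    (forall i v, @trigger n pol S1 i v <= T) ->
    (forall i v, @trigger n pol S2 i v <= T) ->
    tm_decides_within M (enc_instance S1 S2)
      (c * (size (enc_instance S1 S2)).+1 ^ d) (equivalent psi S1 S2).
Proof.
move=> psiE; have [c [d bound]] := polybound_tm_time T.
exists (cmd_TM (setup ;; Program pol T ;; verdict 0)), c, d.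
move=> n S1 S2 [k1 _] [k2 _] tr1 tr2.
apply: tm_decides_within_mono (bound _) _.
set nums := numbers S1 S2; rewrite -[enc_instance S1 S2]/(encs nums).
set m := size _; pose b2 := base2 n (nlayers S1).
have num2 : nth 0 nums b2 = nlayers S2 by rewrite -[b2]addn0 nth_nums_2.
have size_nums : size nums = b2.+1 + nlayers S2 * (n * n) + nlayers S2 * n.
  rewrite -[size nums]/((size (nats_of_tmsyds S1 ++ nats_of_tmsyds S2)).+1).
  by rewrite size_cat !size_nats_of_tmsyds /b2 /base2; lia.
have sm : 2 * size nums <= m := size_encs nums.
have [s' [run out]] : exists s', runs (encs nums) (30 + 2 * T) (Program pol T)
    (fun=> 0, 0) (s', 0) (cprogram T m) /\ (s' 0 = 0 <-> equivalent psi S1 S2).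
  (* Without nodes there is a single configuration, so any two systems are equivalent; the program
     reads 0 and stops with register 0 still 0. *)
  case: (posnP n) => n0.
    exists (fun=> 0); split.
      apply: (@runs_le _ _ _ _ _ (cost_read m + 1)); first by rewrite /cprogram; lia.
      apply: (@runs_seq _ _ _ _ _ (fun=> 0, 0)); last first.
        by apply: runs_ifnz => //; apply: runs_nop.
      have := @runs_read nums (30 + 2 * T) m (R30 T) (leqnn m) 1 (fun=> 0) 0.
      have -> : nth 0 nums 0 = 0 by rewrite /= n0.
      rewrite pos0 => H; have := H; rewrite -[in upd _ _ 0]/((fun=> 0) 1) upd_same.
      by apply; rewrite ?size_nums //; lia.
    split=> // _ C; apply/ffunP => v; exfalso; have := ltn_ord v; lia.
  (* For [n > 0] the matrices dominate: [n] and the layer counts are at most the length of the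
     number list, hence of the input. *)
  have nn : n <= n * n by rewrite leq_pmulr.
  have nk1 : nlayers S1 <= nlayers S1 * (n * n) by rewrite leq_pmulr ?muln_gt0 ?n0.
  have nk2 : nlayers S2 <= nlayers S2 * (n * n) by rewrite leq_pmulr ?muln_gt0 ?n0.
  have nk : n <= nlayers S1 * n by rewrite leq_pmull.
  have := @runs_program pol T nums n (nlayers S1) (nlayers S2) m (leqnn m).
  case=> //; try by rewrite /b2 /base2 in size_nums; lia.
  move=> s' [run out]; exists s'; split=> //.
  rewrite out nbad_fires (equivalent_fires psiE).
  split=> [H|H B v _]; last exact: H.
  exact: fires_eq_small tr1 tr2 H.
apply: program_decides run _ out => //; lia.
Qed.

Lemma card_nbhd n (S : tmsyds n) (i : 'I_(nlayers S)) v :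
  #|nbhd i v| <= (deg S i v).+1.
Proof.
have -> : nbhd i v = v |: [set u | adj S i v u] by apply/setP => u; rewrite !inE.
by rewrite cardsU1 /deg -[X in _ <= X.+1]cardsE -add1n leq_add2r leq_b1.
Qed.

Theorem theorem5p4 :
  (forall T : nat,
     exists (M : TM) (c d : nat),
       forall (n : nat) (S1 S2 : tmsyds n),
         wf_tmsyds S1 -> wf_tmsyds S2 ->
         thr_at_most T S1 -> thr_at_most T S2 ->
         tm_decides_within M (enc_instance S1 S2)
           (c * (size (enc_instance S1 S2)).+1 ^ d)
           (equivalent OR_fun S1 S2)) /\
  (forall N : nat,
     exists (M : TM) (c d : nat),
       forall (n : nat) (S1 S2 : tmsyds n),
         wf_tmsyds S1 -> wf_tmsyds S2 ->
         negthr_at_most N S1 -> negthr_at_most N S2 ->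
         tm_decides_within M (enc_instance S1 S2)
           (c * (size (enc_instance S1 S2)).+1 ^ d)
           (equivalent AND_fun S1 S2)).
Proof.
split=> [T|N].
  have [|M [c [d H]]] := @equivalence_decidable false OR_fun T.
    by move=> s; rewrite addbF; apply: eq_has => b; rewrite addbF.
  exists M, c, d => n S1 S2 wf1 wf2 T1 T2; exact: H.
have [|M [c [d H]]] := @equivalence_decidable true AND_fun N.
  by move=> s; rewrite addbT -has_predC; apply: eq_has => b; rewrite addbT.
(* By [card_nbhd] the trigger is at most [deg + 2 - thr], the negative threshold. *)
have trigger_le n (S : tmsyds n) : negthr_at_most N S -> forall i v, @trigger n true S i v <= N.
  by move=> NS i v; have := NS i v; have := card_nbhd i v; rewrite /trigger; lia.
by exists M, c, d => n S1 S2 wf1 wf2 N1 N2; apply: H => //; apply: trigger_le.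
Qed.
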